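(* A complex $3$-dimensional algebra is a symmetric mono Leibniz algebra if and only if it is isomorphic to one of the following algebras (basis $e_1,e_2,e_3$; products not written are zero; $\alpha\in\mathbb{C}$): - $\mathfrak{g}_1$: $e_2e_3=e_1$, $e_3e_2=-e_1$; - $\mathfrak{g}_2$: $e_1e_3=e_1$, $e_2e_3=e_2$, $e_3e_1=-e_1$, $e_3e_2=-e_2$; - $\mathfrak{g}_3^{\alpha}$: $e_1e_3=e_1+e_2$, $e_2e_3=\alpha e_2$, $e_3e_1=-e_1-e_2$, $e_3e_2=-\alpha e_2$; - $\mathfrak{g}_4$: $e_1e_2=e_3$, $e_1e_3=-e_2$, $e_2e_3=e_1$, $e_2e_1=-e_3$, $e_3e_1=e_2$, $e_3e_2=-e_1$; - $\mathcal{A}_1^{\alpha}$: $e_1e_2=e_3$, $e_1e_3=e_1+e_3$, $e_2e_3=\alpha e_2$, $e_2e_1=-e_3$, $e_3e_1=-e_1-e_3$, $e_3e_2=-\alpha e_2$; - $\mathcal{A}_2$: $e_1e_2=e_1$, $e_2e_3=e_2$, $e_2e_1=-e_1$, $e_3e_2=-e_2$; - $\mathcal{A}_3$: $e_1e_2=e_3$, $e_1e_3=e_1$, $e_2e_3=e_2$, $e_2e_1=-e_3$, $e_3e_1=-e_1$, $e_3e_2=-e_2$; - $\mathcal{N}_1$: $e_1e_1=e_2$; - $\mathcal{N}_2$: $e_1e_1=e_2$, $e_1e_3=e_1$, $e_3e_1=-e_1$; - $\mathcal{N}_3$: $e_1e_1=e_2$, $e_1e_3=e_3$, $e_3e_1=-e_3$;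 - $\mathcal{N}_4$: $e_1e_1=e_2$, $e_1e_3=e_2$, $e_3e_1=-e_2$; - $\mathcal{N}_5$: $e_1e_1=e_2$, $e_1e_3=e_3$, $e_3e_1=-e_3$, $e_3e_3=e_2$; - $\mathcal{N}_6^{\alpha}$: $e_1e_1=e_2$, $e_1e_3=\alpha e_2$, $e_3e_1=-\alpha e_2$, $e_3e_3=e_2$. These algebras are pairwise non-isomorphic, except that $\mathfrak{g}_3^{\alpha}\cong\mathfrak{g}_3^{\alpha^{-1}}$ and $\mathcal{A}_1^{\alpha}\cong\mathcal{A}_1^{\alpha^{-1}}$ (for $\alpha\ne0$), and $\mathcal{N}_6^{\alpha}\cong\mathcal{N}_6^{-\alpha}$.
   Context: An algebra is a complex vector space with a bilinear multiplication, not necessarily associative. A right Leibniz algebra is an algebra satisfying $x(yz)=(xy)z+y(xz)$; a left Leibniz algebra is an algebra satisfying the mirror identity $(xy)z=(xz)y+x(yz)$. An algebra is right (respectively left) mono Leibniz if each of its one-generated subalgebras is a right (respectively left) Leibniz algebra. A symmetric mono Leibniz algebra is an algebra that is both right mono Leibniz and left mono Leibniz.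
   Formalization: The printed list is incomplete: the formal classification adds the zero algebra and the algebra e1e3 = e1+e2, e3e1 = -e1+e2 (other products zero), both symmetric mono Leibniz, and also proves that the latter is isomorphic to no listed algebra. *)

(* Defs.v *)
From HB Require Import structures.
From mathcomp Require Import all_boot all_order all_algebra.
From mathcomp Require Import complex.
From mathcomp Require Import classical_sets reals.

Set Implicit Arguments.
Unset Strict Implicit.
Unset Printing Implicit Defensive.

Import GRing.Theory.

Local Open Scope ring_scope.
Local Open Scope classical_set_scope.

(** An algebra is a module [V] with a multiplication
    [mul : {bilinear V -> V -> V}]; associativity is not assumed. *)

Section Algebras.
Context {K : fieldType} {V : lmodType K} (mul : {bilinear V -> V -> V}).
Local Notation "x ** y" := (mul x y) (at level 40, left associativity).

Definition subalgebra (S : set V) : Prop :=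
  [/\ S 0,
      forall (a : K) x y, S x -> S y -> S (a *: x + y) &
      forall x y, S x -> S y -> S (x ** y)].

Definition one_generated (x : V) : set V := smallest subalgebra [set x].

(** The two identities are relative to a subset [S] so that they can be
    stated for the subalgebras of [V]; [V] itself is the case [S = setT]. *)
Definition right_leibniz (S : set V) : Prop :=
  forall x y z, S x -> S y -> S z -> x ** (y ** z) = (x ** y) ** z + y ** (x ** z).

Definition left_leibniz (S : set V) : Prop :=
  forall x y z, S x -> S y -> S z -> (x ** y) ** z = (x ** z) ** y + x ** (y ** z).

Definition right_mono_leibniz : Prop :=
  forall x, right_leibniz (one_generated x).

Definition left_mono_leibniz : Prop :=
  forall x, left_leibniz (one_generated x).

Definition symmetric_mono_leibniz : Prop :=
  right_mono_leibniz /\ left_mono_leibniz.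

Definition zero_algebra : Prop := forall x y, x ** y = 0.

End Algebras.

Definition isomorphic {K : fieldType} {V W : lmodType K}
    (mulV : {bilinear V -> V -> V}) (mulW : {bilinear W -> W -> W}) : Prop :=
  exists2 f : {linear V -> W}, bijective f & {morph f : x y / mulV x y >-> mulW x y}.

(** A multiplication table lists triples [(i, j, w)], each meaning
    [e_i e_j = w]; the products that are not listed are zero. *)

Definition table (K : fieldType) := seq ('I_3 * 'I_3 * 'rV[K]_3).

Section TableProduct.
Context {K : fieldType} (t : table K).

Definition table_mul (u v : 'rV[K]_3) : 'rV[K]_3 :=
  \sum_(p <- t) (u 0 p.1.1 * v 0 p.1.2) *: p.2.

Lemma table_mul_bilinear : bilinear_for *:%R *:%R table_mul.
Proof.
split=> [v|u] a x y; rewrite /= /table_mul scaler_sumr -big_split /=;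
  apply: eq_bigr => p _; rewrite !mxE scalerA -scalerDl.
  by rewrite mulrDl mulrA.
by rewrite mulrDr mulrCA.
Qed.

HB.instance Definition _ :=
  bilinear_isBilinear.Build K 'rV[K]_3 'rV[K]_3 'rV[K]_3 *:%R *:%R table_mul
    table_mul_bilinear.

End TableProduct.

(** The names of the algebras of the classification. *)
Inductive name (K : Type) : Type :=
  | G1 | G2 | G3 of K | G4
  | A1 of K | A2 | A3
  | N1 | N2 | N3 | N4 | N5 | N6 of K.

Arguments G1 {K}. Arguments G2 {K}. Arguments G4 {K}.
Arguments A2 {K}. Arguments A3 {K}.
Arguments N1 {K}. Arguments N2 {K}. Arguments N3 {K}. Arguments N4 {K}.
Arguments N5 {K}.

Section Tables.
Context {K : fieldType}.

Let i1 : 'I_3 := Ordinal (isT : (0 < 3)%N).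
Let i2 : 'I_3 := Ordinal (isT : (1 < 3)%N).
Let i3 : 'I_3 := Ordinal (isT : (2 < 3)%N).
Let e1 : 'rV[K]_3 := 'e_i1.
Let e2 : 'rV[K]_3 := 'e_i2.
Let e3 : 'rV[K]_3 := 'e_i3.

Definition table_of (s : name K) : table K :=
  match s with
  | G1 => [:: (i2, i3, e1); (i3, i2, - e1)]
  | G2 => [:: (i1, i3, e1); (i2, i3, e2); (i3, i1, - e1); (i3, i2, - e2)]
  | G3 a => [:: (i1, i3, e1 + e2); (i2, i3, a *: e2);
                (i3, i1, - e1 - e2); (i3, i2, - a *: e2)]
  | G4 => [:: (i1, i2, e3); (i1, i3, - e2); (i2, i3, e1);
              (i2, i1, - e3); (i3, i1, e2); (i3, i2, - e1)]
  | A1 a => [:: (i1, i2, e3); (i1, i3, e1 + e3); (i2, i3, a *: e2);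
                (i2, i1, - e3); (i3, i1, - e1 - e3); (i3, i2, - a *: e2)]
  | A2 => [:: (i1, i2, e1); (i2, i3, e2); (i2, i1, - e1); (i3, i2, - e2)]
  | A3 => [:: (i1, i2, e3); (i1, i3, e1); (i2, i3, e2);
              (i2, i1, - e3); (i3, i1, - e1); (i3, i2, - e2)]
  | N1 => [:: (i1, i1, e2)]
  | N2 => [:: (i1, i1, e2); (i1, i3, e1); (i3, i1, - e1)]
  | N3 => [:: (i1, i1, e2); (i1, i3, e3); (i3, i1, - e3)]
  | N4 => [:: (i1, i1, e2); (i1, i3, e2); (i3, i1, - e2)]
  | N5 => [:: (i1, i1, e2); (i1, i3, e3); (i3, i1, - e3); (i3, i3, e2)]
  | N6 a => [:: (i1, i1, e2); (i1, i3, a *: e2); (i3, i1, - a *: e2);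
                (i3, i3, e2)]
  end.

Definition alg (s : name K) : {bilinear 'rV[K]_3 -> 'rV[K]_3 -> 'rV[K]_3} :=
  table_mul (table_of s).

(** The published list lacks this algebra, which is not isomorphic to any
    algebra of the list. With x = a e1 + b e2 + c e3 one has
    x x = 2 a c e2, and e2 annihilates everything, so each one-generated
    subalgebra is nilpotent of class at most 2 and satisfies both Leibniz
    identities. Its squares form a rank 2 quadratic form, as in N5 and N6,
    but the line spanned by the commutators [x, y] is isotropic for it. *)
Definition missing_alg : {bilinear 'rV[K]_3 -> 'rV[K]_3 -> 'rV[K]_3} :=
  table_mul [:: (i1, i3, e1 + e2); (i3, i1, - e1 + e2)].

(** The coincidences between members of the list with distinct names. *)
Definition exceptional_pair (s t : name K) : Prop :=
  match s, t with
  | G3 a, G3 b => a != 0 /\ b = a^-1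
  | A1 a, A1 b => a != 0 /\ b = a^-1
  | N6 a, N6 b => b = - a
  | _, _ => False
  end.

End Tables.

(* Main.v *)
From HB Require Import structures.
Require Import Defs.
From mathcomp Require Import all_boot all_order all_algebra.
From mathcomp Require Import complex.
From mathcomp Require Import classical_sets reals.
From mathcomp Require Import ring.

Set Implicit Arguments.
Unset Strict Implicit.
Unset Printing Implicit Defensive.

Import Order.TTheory GRing.Theory Num.Theory.

Local Open Scope ring_scope.

(** Write xx for the square of x. At (x, x, x) the two Leibniz identities say
    that (xx) x = 0 and x (xx) = 0. Conversely, polarising these cubic
    identities gives (xx)(xx) = 0, so that the subalgebra generated by x is
    spanned by x and xx and all its triple products vanish: an algebra is
    symmetric mono Leibniz exactly when x (xx) = (xx) x = 0 for all x, see
    [cube_zero_of_mono_leibniz] and [mono_leibniz_of_cube_zero].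

    Suppose first that every square is zero. In dimension 3 an alternating
    product factors through the cross product, x y = (x cross y) M for a matrix
    M, and a change of basis P turns M into P^T M P / det P. Over a field the
    scalar matrices absorb the factor, so isomorphism is congruence of bilinear
    forms up to a nonzero scalar [congruent_isomorphic]. These forms are
    classified by the symmetric part S of M and, if M is not symmetric, by the kernel
    a of its skew part [forms_classified]: if S a a is not zero, the line of a splits off and a
    nondegenerate skew plane remains (A1, A3); if S a a = 0 but S a is not zero,
    the form is A2 or A1 with parameter -1; if S a = 0, the form lives on a plane
    (G2, G3); if M is symmetric, its rank decides (the zero algebra, G1, G3 with
    parameter -1, G4).

    Suppose now that n = xx is not zero. The polarised identities force, in a
    basis x, n, y, that n annihilates the algebra and that all squares are
    multiples of n [cube_zero_square_alg]. Such an algebra is a quadratic form q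
    on the quotient by n together with w = (xy - yx) / 2. When q has rank
    1 the position of w with respect to the radical of q gives N1, N2, N3 or N4;
    when q has rank 2, w is a multiple of n (N6), or its class is nonisotropic
    (N5), or its class is isotropic, which is [missing_alg];
    see [listed_square].

    The same data separate the algebras. For forms, the vanishing of a, S,
    adj S, S a and of the pair (det S, S a a) is invariant and tells the families
    apart. The parameter in G3 or A1 comes from ratios of quantities that are
    transformed alike: adj S against a^T a for G3, det S against S a a for A1.
    In both cases this is the ratio of (b - 1)^2 to (b + 1)^2, up to a constant, and
    it determines b up to inversion [inverse_parameters]. For a quadratic form with a commutator one
    uses whether q is degenerate, whether w and its class are zero, and whether
    the class of w is isotropic. *)

(** * Coordinates on the three-dimensional space *)

Local Notation i1 := (Ordinal (isT : (0 < 3)%N)).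
Local Notation i2 := (Ordinal (isT : (1 < 3)%N)).
Local Notation i3 := (Ordinal (isT : (2 < 3)%N)).

Section Coordinates.
Context {K : fieldType}.
Implicit Types (a b c : K) (u v x y : 'rV[K]_3).

Definition rv3 a b c : 'rV[K]_3 := \row_j nth 0 [:: a; b; c] j.

Definition mx3 a11 a12 a13 a21 a22 a23 a31 a32 a33 : 'M[K]_3 :=
  \matrix_(i, j)
    nth 0 (nth [::] [:: [:: a11; a12; a13]; [:: a21; a22; a23]; [:: a31; a32; a33]] i) j.

Lemma ord3P (P : 'I_3 -> Prop) : P i1 -> P i2 -> P i3 -> forall i, P i.
Proof.
move=> P1 P2 P3 [[|[|[|//]]] ilt].
- by rewrite (_ : Ordinal ilt = i1) //; apply/val_inj.
- by rewrite (_ : Ordinal ilt = i2) //; apply/val_inj.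
- by rewrite (_ : Ordinal ilt = i3) //; apply/val_inj.
Qed.

Lemma sum3 (V : nmodType) (F : 'I_3 -> V) : \sum_i F i = F i1 + F i2 + F i3.
Proof.
rewrite !big_ord_recl big_ord0 addr0 addrA.
by congr (F _ + F _ + F _); apply/val_inj.
Qed.

Lemma rv3_eta u : u = rv3 (u 0 i1) (u 0 i2) (u 0 i3).
Proof. by apply/rowP; apply: ord3P; rewrite mxE. Qed.

Lemma mx3_eta (M : 'M[K]_3) :
  M = mx3 (M i1 i1) (M i1 i2) (M i1 i3) (M i2 i1) (M i2 i2) (M i2 i3)
          (M i3 i1) (M i3 i2) (M i3 i3).
Proof. by apply/matrixP; apply: ord3P; apply: ord3P; rewrite mxE. Qed.

Lemma rv3D a b c a' b' c' : rv3 a b c + rv3 a' b' c' = rv3 (a + a') (b + b') (c + c').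
Proof. by apply/rowP; apply: ord3P; rewrite !mxE. Qed.

Lemma rv3Z k a b c : k *: rv3 a b c = rv3 (k * a) (k * b) (k * c).
Proof. by apply/rowP; apply: ord3P; rewrite !mxE. Qed.

Lemma rv3N a b c : - rv3 a b c = rv3 (- a) (- b) (- c).
Proof. by apply/rowP; apply: ord3P; rewrite !mxE. Qed.

Lemma rv30 : rv3 0 0 0 = 0.
Proof. by apply/rowP; apply: ord3P; rewrite !mxE. Qed.

Lemma rv3_delta : ('e_i1 = rv3 1 0 0) * ('e_i2 = rv3 0 1 0) * ('e_i3 = rv3 0 0 1).
Proof. by do !split; apply/rowP; apply: ord3P; rewrite !mxE. Qed.

Lemma rv3_entry a b c :
  (rv3 a b c 0 i1 = a) * (rv3 a b c 0 i2 = b) * (rv3 a b c 0 i3 = c).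
Proof. by do !split; rewrite mxE. Qed.

Lemma rv3_inj a b c a' b' c' :
  rv3 a b c = rv3 a' b' c' -> [/\ a = a', b = b' & c = c'].
Proof.
move=> E; have := (congr1 (fun u : 'rV_3 => (u 0 i1, u 0 i2, u 0 i3)) E).
by rewrite !rv3_entry => -[].
Qed.

Lemma rv3M a b c a11 a12 a13 a21 a22 a23 a31 a32 a33 :
  rv3 a b c *m mx3 a11 a12 a13 a21 a22 a23 a31 a32 a33 =
  rv3 (a * a11 + b * a21 + c * a31) (a * a12 + b * a22 + c * a32)
      (a * a13 + b * a23 + c * a33).
Proof. by apply/rowP; apply: ord3P; rewrite !mxE sum3 !mxE. Qed.

Lemma mx3M a11 a12 a13 a21 a22 a23 a31 a32 a33 b11 b12 b13 b21 b22 b23 b31 b32 b33 :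
  mx3 a11 a12 a13 a21 a22 a23 a31 a32 a33 *m mx3 b11 b12 b13 b21 b22 b23 b31 b32 b33 =
  mx3 (a11 * b11 + a12 * b21 + a13 * b31) (a11 * b12 + a12 * b22 + a13 * b32)
      (a11 * b13 + a12 * b23 + a13 * b33)
      (a21 * b11 + a22 * b21 + a23 * b31) (a21 * b12 + a22 * b22 + a23 * b32)
      (a21 * b13 + a22 * b23 + a23 * b33)
      (a31 * b11 + a32 * b21 + a33 * b31) (a31 * b12 + a32 * b22 + a33 * b32)
      (a31 * b13 + a32 * b23 + a33 * b33).
Proof. by apply/matrixP; apply: ord3P; apply: ord3P; rewrite !mxE sum3 !mxE. Qed.

Lemma trmx3 a11 a12 a13 a21 a22 a23 a31 a32 a33 :
  (mx3 a11 a12 a13 a21 a22 a23 a31 a32 a33)^T =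
  mx3 a11 a21 a31 a12 a22 a32 a13 a23 a33.
Proof. by apply/matrixP; apply: ord3P; apply: ord3P; rewrite !mxE. Qed.

Lemma mx3Z k a11 a12 a13 a21 a22 a23 a31 a32 a33 :
  k *: mx3 a11 a12 a13 a21 a22 a23 a31 a32 a33 =
  mx3 (k * a11) (k * a12) (k * a13) (k * a21) (k * a22) (k * a23)
      (k * a31) (k * a32) (k * a33).
Proof. by apply/matrixP; apply: ord3P; apply: ord3P; rewrite !mxE. Qed.

Lemma mx3D a11 a12 a13 a21 a22 a23 a31 a32 a33 b11 b12 b13 b21 b22 b23 b31 b32 b33 :
  mx3 a11 a12 a13 a21 a22 a23 a31 a32 a33 + mx3 b11 b12 b13 b21 b22 b23 b31 b32 b33 =
  mx3 (a11 + b11) (a12 + b12) (a13 + b13) (a21 + b21) (a22 + b22) (a23 + b23)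
      (a31 + b31) (a32 + b32) (a33 + b33).
Proof. by apply/matrixP; apply: ord3P; apply: ord3P; rewrite !mxE. Qed.

Lemma det_mx3 a11 a12 a13 a21 a22 a23 a31 a32 a33 :
  \det (mx3 a11 a12 a13 a21 a22 a23 a31 a32 a33) =
  a11 * (a22 * a33 - a23 * a32) - a12 * (a21 * a33 - a23 * a31)
  + a13 * (a21 * a32 - a22 * a31).
Proof.
rewrite (expand_det_row _ i1) sum3 /cofactor.
do !rewrite (expand_det_row _ 0) !big_ord_recl big_ord0 /cofactor !det_mx11.
rewrite !mxE /= .
rewrite !(expr0, expr1, exprS). ring.
Qed.

Lemma adj_mx3 a11 a12 a13 a21 a22 a23 a31 a32 a33 :
  \adj (mx3 a11 a12 a13 a21 a22 a23 a31 a32 a33) =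
  mx3 (a22 * a33 - a23 * a32) (a13 * a32 - a12 * a33) (a12 * a23 - a13 * a22)
      (a23 * a31 - a21 * a33) (a11 * a33 - a13 * a31) (a13 * a21 - a11 * a23)
      (a21 * a32 - a22 * a31) (a12 * a31 - a11 * a32) (a11 * a22 - a12 * a21).
Proof.
apply/matrixP; apply: ord3P; apply: ord3P; rewrite !mxE /cofactor;
  rewrite (expand_det_row _ 0) !big_ord_recl big_ord0 /cofactor !det_mx11 !mxE /=.
all: rewrite !(expr0, expr1, exprS); ring.
Qed.

Lemma rv3_eq0 (a b c : K) : (rv3 a b c == 0) = [&& a == 0, b == 0 & c == 0].
Proof.
rewrite -rv30; apply/eqP/and3P => [/rv3_inj[-> -> ->] // | [/eqP -> /eqP -> /eqP -> //]].
Qed.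

Lemma mx3_eq0 (a11 a12 a13 a21 a22 a23 a31 a32 a33 : K) :
  (mx3 a11 a12 a13 a21 a22 a23 a31 a32 a33 == 0) =
  [&& a11 == 0, a12 == 0, a13 == 0, a21 == 0, a22 == 0, a23 == 0,
      a31 == 0, a32 == 0 & a33 == 0].
Proof.
apply/eqP/idP => [/matrixP E | ].
  have F i j := congr1 (fun x : K => x == 0) (E i j).
  have := (F i1 i1, F i1 i2, F i1 i3, F i2 i1, F i2 i2, F i2 i3, F i3 i1, F i3 i2, F i3 i3).
  by rewrite !mxE /= eqxx => -[[[[[[[[-> ->] ->] ->] ->] ->] ->] ->] ->].
do 8![case/andP => /eqP ->]; move=> /eqP ->.
by apply/matrixP; apply: ord3P; apply: ord3P; rewrite !mxE.
Qed.

Lemma rv3_dot (a b c a' b' c' : K) :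
  (rv3 a b c *m (rv3 a' b' c')^T == 0) = (a * a' + b * b' + c * c' == 0).
Proof.
apply/eqP/eqP => [/matrixP/(_ 0 0) | E]; first by rewrite !mxE sum3 !mxE.
by apply/matrixP => i j; rewrite !ord1 !mxE sum3 !mxE.
Qed.

End Coordinates.

Ltac simpl_det :=
  rewrite det_mx3 ?(mul0r, mul1r, mulr1, mulr0, mulrN1, mulN1r, subr0, addr0, sub0r,
                    add0r, oppr0, subrr, opprK).

(** * Isomorphisms of algebras *)

Section Isomorphisms.
Context {K : fieldType}.

Lemma isomorphic_trans (U V W : lmodType K) (mU : {bilinear U -> U -> U})
    (mV : {bilinear V -> V -> V}) (mW : {bilinear W -> W -> W}) :
  isomorphic mU mV -> isomorphic mV mW -> isomorphic mU mW.
Proof.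
move=> [f fbij fM] [g gbij gM]; exists (g \o f); first exact: bij_comp.
by move=> x y /=; rewrite fM gM.
Qed.

(** Pointwise equality is the usual way to recognise a table, because two tables
    with the same products need not be equal as lists. *)
Lemma isomorphic_eq (V : lmodType K) (m m' : {bilinear V -> V -> V}) :
  (forall x y, m x y = m' x y) -> isomorphic m m'.
Proof. by move=> E; exists (@idfun V); [exists id | move=> x y /=]. Qed.

Lemma isomorphic_sym (V W : lmodType K) (m : {bilinear V -> V -> V})
    (m' : {bilinear W -> W -> W}) :
  isomorphic m m' -> isomorphic m' m.
Proof.
move=> [f [g fK gK] fM].
have glin : linear g by apply: can2_linear fK gK.
exists (HB.pack g (GRing.isLinear.Build K W V *:%R g glin) : {linear W -> V}).
  by exists f.
by move=> x y; apply: (can_inj fK); rewrite fM /= !gK.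
Qed.

Lemma isomorphic_alternating (V W : lmodType K) (m : {bilinear V -> V -> V})
    (m' : {bilinear W -> W -> W}) :
  isomorphic m m' -> (forall x, m x x = 0) -> forall x, m' x x = 0.
Proof. by move=> [f [g fK gK] fM] alt x; rewrite -[x]gK -fM alt linear0. Qed.

Lemma bilinear_sum (V W : lmodType K) (m : {bilinear V -> V -> W}) (n : nat)
    (b : 'I_n -> V) (u v : 'I_n -> K) :
  m (\sum_i u i *: b i) (\sum_i v i *: b i) =
  \sum_i u i *: \sum_j v j *: m (b i) (b j).
Proof.
rewrite linear_sumlz; apply: eq_bigr => i _; rewrite linearZl_LR linear_sumr.
by congr (_ *: _); apply: eq_bigr => j _; rewrite linearZr_LR.
Qed.

(** The isomorphism is the map to coordinates in [b]. *)
Lemma isomorphic_basis (V : vectType K) (mV : {bilinear V -> V -> V})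
    (m : {bilinear 'rV[K]_3 -> 'rV[K]_3 -> 'rV[K]_3}) (b : 3.-tuple V) :
  basis_of fullv b ->
  (forall i j : 'I_3, mV b`_i b`_j = \sum_k m 'e_i 'e_j 0 k *: b`_k) ->
  isomorphic mV m.
Proof.
move=> bV bM; have b_free := basis_free bV.
pose f v := \row_i coord b i v.
have flin : linear f by move=> a u v; apply/rowP => i; rewrite !mxE linearP.
pose fL : {linear V -> 'rV[K]_3} :=
  HB.pack f (GRing.isLinear.Build K V 'rV[K]_3 *:%R f flin).
have f_sum (c : 'I_3 -> K) (w : 'I_3 -> V) :
    f (\sum_i c i *: w i) = \sum_i c i *: f (w i).
  apply/rowP => j; rewrite !mxE linear_sum summxE.
  by apply: eq_bigr => i _; rewrite linearZ !mxE.
have fE (i : 'I_3) : f b`_i = 'e_i.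
  by apply/rowP => j; rewrite !mxE coord_free // eqxx eq_sym.
have fK : cancel f (fun u => \sum_i u 0 i *: b`_i).
  move=> v; rewrite [RHS](coord_basis bV (memvf v)).
  by apply: eq_bigr => i _; rewrite mxE.
have Kf : cancel (fun u : 'rV[K]_3 => \sum_i u 0 i *: b`_i) f.
  move=> u; rewrite f_sum [RHS]row_sum_delta.
  by apply: eq_bigr => i _; rewrite fE.
exists fL; first by exists (fun u : 'rV[K]_3 => \sum_i u 0 i *: b`_i).
suff fM x y : f (mV x y) = m (f x) (f y) by move=> x y; apply: fM.
rewrite -[x]fK -[y]fK; move: (f x) (f y) => u v; rewrite !Kf.
rewrite [in RHS](row_sum_delta u) [in RHS](row_sum_delta v).
rewrite !bilinear_sum f_sum; apply: eq_bigr => i _; congr (_ *: _).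
rewrite f_sum; apply: eq_bigr => j _; congr (_ *: _).
rewrite bM f_sum [RHS]row_sum_delta; apply: eq_bigr => k _.
by rewrite fE.
Qed.

Context (m m' : {bilinear 'rV[K]_3 -> 'rV[K]_3 -> 'rV[K]_3}).

Lemma isomorphic_mx (P : 'M[K]_3) :
  \det P != 0 -> (forall x y, m x y *m P = m' (x *m P) (y *m P)) ->
  isomorphic m m'.
Proof.
rewrite -unitfE => Pu PM; exists (mulmxr P) => //.
by exists (mulmxr (invmx P)) => x /=; rewrite (mulmxK, mulmxKV).
Qed.

Lemma mx_isomorphic :
  isomorphic m m' ->
  exists2 P : 'M[K]_3, \det P != 0 & forall x y, m x y *m P = m' (x *m P) (y *m P).
Proof.
move=> [f [g fK gK] fM]; exists (lin1_mx f); last first.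
  by move=> x y; rewrite !mul_rV_lin1 fM.
have glin : linear g by apply: can2_linear fK gK.
pose gL : {linear 'rV[K]_3 -> 'rV[K]_3} :=
  HB.pack g (GRing.isLinear.Build K 'rV[K]_3 'rV[K]_3 *:%R g glin).
have PQ : lin1_mx f *m lin1_mx gL = 1%:M.
  by apply/row_matrixP => i; rewrite !rowE mulmxA !mul_rV_lin1 mulmx1 /= fK.
by case/mulmx1_unit: PQ; rewrite unitmxE unitfE.
Qed.

End Isomorphisms.

(** * Mono Leibniz algebras and vanishing cubes *)

Section MonoLeibniz.
Context {K : fieldType} {V : lmodType K} (mul : {bilinear V -> V -> V}).
Hypothesis two_neq0 : 2%:R != 0 :> K.

Definition cube_zero : Prop := forall x, mul x (mul x x) = 0 /\ mul (mul x x) x = 0.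

(** Separates the even part from the odd part of an identity that holds for z and
    for - z. *)
Lemma add_opp_eq0 (x y : V) : x + y = 0 -> - x + y = 0 -> x = 0 /\ y = 0.
Proof.
move=> xy; have -> : y = - x by apply/eqP; rewrite -addr_eq0 addrC xy.
move=> /eqP; rewrite -opprD oppr_eq0 -mulr2n -scaler_nat scaler_eq0 (negbTE two_neq0).
by move=> /eqP ->; rewrite oppr0.
Qed.

Lemma cube_zero_of_mono_leibniz : symmetric_mono_leibniz mul -> cube_zero.
Proof.
move=> [rL lL] x; have xx : one_generated mul x x by move=> A [_]; apply.
have := lL x x x x xx xx xx; have := rL x x x x xx xx xx.
move=> /eqP; rewrite -subr_eq subrr eq_sym => /eqP r.
by rewrite r add0r => <-.
Qed.

Hypothesis cube0 : cube_zero.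

Lemma mul_sqr x : mul x (mul x x) = 0. Proof. by case: (cube0 x). Qed.
Lemma sqr_mul x : mul (mul x x) x = 0. Proof. by case: (cube0 x). Qed.

(** In the expansion of the cube of x + y, the terms of degree 2 in x are separated
    from those of degree 1 by replacing y with - y. *)
Lemma linearized_cube x y :
  mul (mul x y + mul y x) x + mul (mul x x) y = 0 /\
  mul x (mul x y + mul y x) + mul y (mul x x) = 0.
Proof.
have E (z : V) : mul (x + z) (x + z) = mul x x + (mul x z + mul z x) + mul z z.
  by rewrite linearDl !linearDr !addrA.
split.
  have F z : (mul (mul x z + mul z x) x + mul (mul x x) z) +
             (mul (mul x z + mul z x) z + mul (mul z z) x) = 0.
    have := sqr_mul (x + z); rewrite E linearDr !linearDl !sqr_mul !add0r addr0 => <-.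
    by rewrite [RHS]addrACA; congr (_ + _); rewrite addrC.
  have := F (- y); rewrite !(linearNl, linearNr) -opprD !(linearNl, linearNr) opprK.
  by rewrite -opprD !opprK => H; case: (add_opp_eq0 (F y) H).
have F z : (mul x (mul x z + mul z x) + mul z (mul x x)) +
           (mul z (mul x z + mul z x) + mul x (mul z z)) = 0.
  have := mul_sqr (x + z); rewrite E linearDl !linearDr !mul_sqr !add0r addr0 => <-.
  by rewrite [RHS]addrACA; congr (_ + _); rewrite addrC.
have := F (- y); rewrite !(linearNl, linearNr) -opprD !(linearNl, linearNr) opprK.
by rewrite -opprD !opprK => H; case: (add_opp_eq0 (F y) H).
Qed.

Lemma sqr_sqr x : mul (mul x x) (mul x x) = 0.
Proof.
have [+ _] := linearized_cube x (mul x x).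
by rewrite mul_sqr sqr_mul addr0 linear0l add0r.
Qed.

(** The span of x and xx is a subalgebra in which every triple product is zero,
    so that each term of both Leibniz identities vanishes on it. *)
Lemma mono_leibniz_of_cube_zero : symmetric_mono_leibniz mul.
Proof.
have sub x z : one_generated mul x z -> exists a b : K, z = a *: x + b *: mul x x.
  move=> zx; apply: (zx (fun z => exists a b : K, z = a *: x + b *: mul x x)).
  split; last by move=> _ ->; exists 1, 0; rewrite scale1r scale0r addr0.
  split; first by exists 0, 0; rewrite !scale0r addr0.
    move=> k _ _ [a [b ->]] [c [d ->]]; exists (k * a + c), (k * b + d).
    by rewrite scalerDr !scalerA addrACA -!scalerDl.
  move=> _ _ [a [b ->]] [c [d ->]]; exists 0, (a * c).
  rewrite linearDl !linearDr !linearZl_LR !linearZr_LR.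
  by rewrite mul_sqr sqr_mul sqr_sqr !scaler0 !addr0 scale0r add0r scalerA.
have mulE x a b c d : mul (a *: x + b *: mul x x) (c *: x + d *: mul x x) =
    (a * c) *: mul x x.
  rewrite linearDl !linearDr !linearZl_LR !linearZr_LR.
  by rewrite mul_sqr sqr_mul sqr_sqr !scaler0 !addr0 scalerA.
have l0 x k a b : mul (k *: mul x x) (a *: x + b *: mul x x) = 0.
  by rewrite linearDr !linearZl_LR !linearZr_LR sqr_mul sqr_sqr !scaler0 addr0.
have r0 x k a b : mul (a *: x + b *: mul x x) (k *: mul x x) = 0.
  by rewrite linearDl !linearZl_LR !linearZr_LR mul_sqr sqr_sqr !scaler0 addr0.
by split=> x y z w /sub[a [b ->]] /sub[c [d ->]] /sub[e [f ->]]; rewrite !mulE !l0 !r0 addr0.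
Qed.

End MonoLeibniz.

(** * Algebras given by a bilinear form or by a line of squares *)

Section Families.
Context {K : fieldType}.
Implicit Types (x y : 'rV[K]_3) (M N P : 'M[K]_3).

Definition cross x y : 'rV[K]_3 :=
  rv3 (x 0 i2 * y 0 i3 - x 0 i3 * y 0 i2) (x 0 i3 * y 0 i1 - x 0 i1 * y 0 i3)
      (x 0 i1 * y 0 i2 - x 0 i2 * y 0 i1).

(** The cross product identifies the second exterior power with the dual, on which
    P acts by its cofactor matrix. *)
Lemma crossM x y P : cross (x *m P) (y *m P) = cross x y *m (\adj P)^T.
Proof.
rewrite (rv3_eta x) (rv3_eta y) (mx3_eta P) adj_mx3 trmx3 !rv3M /cross !rv3_entry.
by congr rv3; ring.
Qed.

Lemma cross_mx_inj (A B : 'M[K]_3) :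
  (forall x y, cross x y *m A = cross x y *m B) -> A = B.
Proof.
move=> AB; apply/row_matrixP; apply: ord3P; rewrite !rowE !rv3_delta.
- by have := AB 'e_i2 'e_i3; rewrite !rv3_delta /cross !rv3_entry
    !(mul0r, mul1r, mulr0, subr0, sub0r, oppr0, addr0).
- by have := AB 'e_i3 'e_i1; rewrite !rv3_delta /cross !rv3_entry
    !(mul0r, mul1r, mulr0, subr0, sub0r, oppr0, addr0).
- by have := AB 'e_i1 'e_i2; rewrite !rv3_delta /cross !rv3_entry
    !(mul0r, mul1r, mulr0, subr0, sub0r, oppr0, addr0).
Qed.

(** Functoriality of the action of the cofactor matrices on cross products. *)
Lemma adj_mulmx3 (A B : 'M[K]_3) : \adj (A *m B) = \adj B *m \adj A.
Proof.
apply: trmx_inj; rewrite trmx_mul; apply: cross_mx_inj => x y.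
by rewrite -crossM !mulmxA !crossM.
Qed.

(** The product x y = (x cross y) M. In terms of the form M on the dual space, the
    rows of M are the products e2 e3, e3 e1 and e1 e2. *)
Definition form_table M : table K :=
  [:: (i2, i3, row i1 M); (i3, i1, row i2 M); (i1, i2, row i3 M);
      (i3, i2, - row i1 M); (i1, i3, - row i2 M); (i2, i1, - row i3 M)].

Definition form_alg M : {bilinear 'rV[K]_3 -> 'rV[K]_3 -> 'rV[K]_3} :=
  table_mul (form_table M).

Lemma form_algE M x y : form_alg M x y = cross x y *m M.
Proof.
rewrite /form_alg /= /table_mul !big_cons big_nil /=.
by apply/rowP => j; rewrite !mxE sum3 !mxE /=; ring.
Qed.

Lemma form_alg_alternating (M : 'M[K]_3) x : form_alg M x x = 0.
Proof.
rewrite form_algE (_ : cross x x = 0) ?mul0mx // /cross -rv30; congr rv3; ring.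
Qed.

(** The algebra in which e2 annihilates everything, the symmetric part of the
    product is q e2 with q = p x1^2 + 2 t x1 x3 + r x3^2, and half the commutator
    of e1 and e3 is w = a e1 + b e2 + c e3. *)
Definition square_table p t r a b c : table K :=
  [:: (i1, i1, p *: rv3 0 1 0); (i3, i3, r *: rv3 0 1 0);
      (i1, i3, t *: rv3 0 1 0 + rv3 a b c); (i3, i1, t *: rv3 0 1 0 - rv3 a b c)].

Definition square_alg p t r a b c : {bilinear 'rV[K]_3 -> 'rV[K]_3 -> 'rV[K]_3} :=
  table_mul (square_table p t r a b c).

Lemma square_algE p t r a b c (x1 x2 x3 y1 y2 y3 : K) :
  square_alg p t r a b c (rv3 x1 x2 x3) (rv3 y1 y2 y3) =
  rv3 ((x1 * y3 - x3 * y1) * a)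
      (p * x1 * y1 + t * (x1 * y3 + x3 * y1) + r * x3 * y3 + (x1 * y3 - x3 * y1) * b)
      ((x1 * y3 - x3 * y1) * c).
Proof.
rewrite /square_alg /= /table_mul !big_cons big_nil /= !rv3_entry -rv30.
by rewrite !(rv3Z, rv3N, rv3D); congr rv3; ring.
Qed.

Definition form_of (s : name K) : 'M[K]_3 :=
  match s with
  | G1 => mx3 1 0 0 0 0 0 0 0 0
  | G2 => mx3 0 1 0 (- 1) 0 0 0 0 0
  | G3 a => mx3 0 a 0 (- 1) (- 1) 0 0 0 0
  | G4 => mx3 1 0 0 0 1 0 0 0 1
  | A1 a => mx3 0 a 0 (- 1) 0 (- 1) 0 0 1
  | A2 => mx3 0 1 0 0 0 0 1 0 0
  | A3 => mx3 0 1 0 (- 1) 0 0 0 0 1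
  | _ => 0
  end.

Definition anticommutative (s : name K) : bool :=
  match s with
  | N1 | N2 | N3 | N4 | N5 | N6 _ => false
  | _ => true
  end.

Lemma alg_form s x y : anticommutative s -> alg s x y = form_alg (form_of s) x y.
Proof.
case: s => [||a||a||||||||a] //= _; rewrite form_algE /= /table_mul
  !big_cons big_nil /= (rv3_eta x) (rv3_eta y) !rv3_entry !rv3_delta -rv30;
  rewrite !(rv3Z, rv3N, rv3D) /cross !rv3_entry rv3M; congr rv3; ring.
Qed.

Lemma alg_form_iso s : anticommutative s -> isomorphic (alg s) (form_alg (form_of s)).
Proof. by move=> sA; apply: isomorphic_eq => x y; apply: alg_form. Qed.

Definition square_of (s : name K) :=
  match s with
  | N1 => square_alg 1 0 0 0 0 0
  | N2 => square_alg 1 0 0 1 0 0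
  | N3 => square_alg 1 0 0 0 0 1
  | N4 => square_alg 1 0 0 0 1 0
  | N5 => square_alg 1 0 1 0 0 1
  | N6 a => square_alg 1 0 1 0 a 0
  | _ => square_alg 0 0 0 0 0 0
  end.

Lemma alg_square s x y : ~~ anticommutative s -> alg s x y = square_of s x y.
Proof.
case: s => [||a||a||||||||a] //= _; rewrite (rv3_eta x) (rv3_eta y) square_algE
  /= /table_mul !big_cons big_nil /= !rv3_entry !rv3_delta -rv30;
  rewrite !(rv3Z, rv3N, rv3D); congr rv3; ring.
Qed.

Lemma alg_square_iso s : ~~ anticommutative s -> isomorphic (alg s) (square_of s).
Proof. by move=> sN; apply: isomorphic_eq => x y; apply: alg_square. Qed.

Lemma missing_alg_square x y : missing_alg x y = square_alg 0 1 0 1 0 0 x y.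
Proof.
rewrite (rv3_eta x) (rv3_eta y) square_algE
  /= /table_mul !big_cons big_nil /= !rv3_entry !rv3_delta -rv30.
by rewrite !(rv3Z, rv3N, rv3D); congr rv3; ring.
Qed.

Lemma missing_alg_iso : isomorphic (@missing_alg K) (square_alg 0 1 0 1 0 0).
Proof. exact: isomorphic_eq missing_alg_square. Qed.

(** The columns of P are the new basis. The scalar c is harmless for algebras: scaling P by k multiplies P^T M P by
    k^2 and det P by k^3. *)
Definition congruent M N : Prop :=
  exists P c, [/\ \det P != 0, c != 0 & P^T *m M *m P = c *: N].

Lemma congruent_refl (M : 'M[K]_3) : congruent M M.
Proof. by exists 1, 1; rewrite det1 oner_neq0 trmx1 mul1mx mulmx1 scale1r. Qed.

Lemma congruent_trans M N N' : congruent M N -> congruent N N' -> congruent M N'.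
Proof.
move=> [P [c [dP c0 PM]]] [Q [d [dQ d0 QN]]]; exists (P *m Q), (c * d).
split; rewrite ?det_mulmx ?mulf_neq0 // trmx_mul !mulmxA.
by rewrite -(mulmxA _ _ M) -(mulmxA _ _ P) PM -scalemxAr -scalemxAl QN scalerA.
Qed.

(** A multiple Q of P satisfies Q^T M Q = (det Q) N; together with [crossM] this
    says that Q is multiplicative. *)
Lemma congruent_isomorphic M N :
  congruent M N -> isomorphic (form_alg M) (form_alg N).
Proof.
move=> [P [c [dP c0 PM]]]; pose k := c / \det P; pose Q := k *: P.
have k0 : k != 0 by rewrite mulf_neq0 ?invr_neq0.
have dQ : \det Q = k ^+ 2 * c by rewrite detZ /k; field.
have dQ0 : \det Q != 0 by rewrite dQ mulf_neq0 // expf_neq0.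
have QM : Q^T *m M *m Q = \det Q *: N.
  by rewrite /Q [(_ *: _)^T]linearZ /= -scalemxAl -scalemxAl -scalemxAr PM !scalerA dQ.
apply: (isomorphic_mx dQ0) => x y; rewrite !form_algE crossM -!mulmxA; congr (_ *m _).
have Qu : Q^T \in unitmx by rewrite unitmxE det_tr unitfE.
apply: (can_inj (mulKmx Qu)).
by rewrite !mulmxA QM -trmx_mul mul_adj_mx tr_scalar_mx mul_scalar_mx.
Qed.

Lemma form_alg_isomorphic M N :
  isomorphic (form_alg M) (form_alg N) ->
  exists2 P, \det P != 0 & P^T *m M *m P = \det P *: N.
Proof.
case/mx_isomorphic => P P0 PM; exists P => //.
have MP : M *m P = (\adj P)^T *m N.
  by apply: cross_mx_inj => x y; rewrite !mulmxA -form_algE PM form_algE crossM.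
by rewrite -mulmxA MP mulmxA -trmx_mul mul_adj_mx tr_scalar_mx mul_scalar_mx.
Qed.

End Families.

(** * Structure constants *)

Section StructureConstants.
Context {K : fieldType}.

Lemma sum_eq0 (x y z : K) : y = 0 -> z = 0 -> x = y + z -> x = 0.
Proof. by move=> -> -> ->; rewrite addr0. Qed.

Section CoordinateAlgebra.
Context {V : vectType K} (mul : {bilinear V -> V -> V}) (b : 3.-tuple V).

Definition coord_table : table K :=
  [seq (p, \row_k coord b k (mul b`_p.1 b`_p.2)) | p : 'I_3 * 'I_3 <- enum {: 'I_3 * 'I_3}].

Definition coord_alg : {bilinear 'rV[K]_3 -> 'rV[K]_3 -> 'rV[K]_3} :=
  table_mul coord_table.

Lemma coord_algE (i j : 'I_3) : coord_alg 'e_i 'e_j = \row_k coord b k (mul b`_i b`_j).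
Proof.
rewrite /coord_alg /= /table_mul big_map big_enum (bigD1 (i, j)) //= big1 ?addr0.
  by rewrite !mxE !eqxx mul1r scale1r.
by move=> [i' j'] ij; rewrite !mxE /= -natrM mulnb -xpair_eqE (negbTE ij) scale0r.
Qed.

Lemma isomorphic_coord_alg : basis_of fullv b -> isomorphic mul coord_alg.
Proof.
move=> bV; apply: (isomorphic_basis bV) => i j; rewrite coord_algE.
rewrite [LHS](coord_basis bV (memvf _)); by apply: eq_bigr => k _; rewrite mxE.
Qed.

End CoordinateAlgebra.

Lemma bilinear_rv3 (m : {bilinear 'rV[K]_3 -> 'rV[K]_3 -> 'rV[K]_3}) (u v : 'rV[K]_3) :
  m u v = \sum_i u 0 i *: \sum_j v 0 j *: m 'e_i 'e_j.
Proof. by rewrite {1}(row_sum_delta u) {1}(row_sum_delta v) bilinear_sum. Qed.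

Lemma cube_zero_isomorphic (V W : lmodType K) (mV : {bilinear V -> V -> V})
    (mW : {bilinear W -> W -> W}) :
  isomorphic mV mW -> cube_zero mV <-> cube_zero mW.
Proof.
move=> [f [g fK gK] fM]; split=> cube x; last first.
  by split; apply: (can_inj fK); rewrite !fM linear0; case: (cube (f x)).
by rewrite -[x]gK -!fM; case: (cube (g x)) => -> ->; rewrite !linear0.
Qed.

Lemma alternating_form_alg (m : {bilinear 'rV[K]_3 -> 'rV[K]_3 -> 'rV[K]_3}) :
  (forall x, m x x = 0) ->
  exists M, forall x y, m x y = form_alg M x y.
Proof.
pose r := [:: m 'e_i2 'e_i3; m 'e_i3 'e_i1; m 'e_i1 'e_i2].
move=> alt; exists (\matrix_(i < 3) nth 0 r i) => x y; rewrite {}/r.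
have anti u v : m u v = - m v u.
  apply/eqP; rewrite -addr_eq0; apply/eqP; have := alt (u + v).
  by rewrite linearDl !linearDr !alt add0r addr0.
rewrite bilinear_rv3 !sum3 !alt (anti 'e_i2 'e_i1) (anti 'e_i3 'e_i2) (anti 'e_i1 'e_i3).
move: (m 'e_i2 'e_i3) (m 'e_i3 'e_i1) (m 'e_i1 'e_i2) => r1 r2 r3.
rewrite form_algE; apply/rowP => j; rewrite !(mxE, sum3) /=; ring.
Qed.

Hypothesis two_neq0 : 2%:R != 0 :> K.

(** Polarisation at the basis vectors leaves very little freedom. Put s for
    e1 e3 + e3 e1. The identities at (e1, e3) express e2 e3 and e3 e2 through the
    products of e1 and e3; then those at (e2, e3) annihilate the third coordinate
    of s, the cube of e3 that of e3 e3, and the identities at (e3, e1) the first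
    coordinates of s and of e3 e3. *)
Lemma cube_zero_square_alg (m : {bilinear 'rV[K]_3 -> 'rV[K]_3 -> 'rV[K]_3}) :
  cube_zero m -> m 'e_i1 'e_i1 = 'e_i2 ->
  exists t r a b c, forall x y, m x y = square_alg 1 t r a b c x y.
Proof.
move=> cube sq1; have lin := linearized_cube two_neq0 cube.
have [m12 m21] : m 'e_i1 'e_i2 = 0 /\ m 'e_i2 'e_i1 = 0.
  by rewrite -sq1; apply: cube.
have m22 : m 'e_i2 'e_i2 = 0 by rewrite -sq1; apply: sqr_sqr.
have mE x1 x2 x3 y1 y2 y3 : m (rv3 x1 x2 x3) (rv3 y1 y2 y3) =
    rv3 0 (x1 * y1) 0 + (x1 * y3) *: m 'e_i1 'e_i3 + (x3 * y1) *: m 'e_i3 'e_i1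
    + (x2 * y3) *: m 'e_i2 'e_i3 + (x3 * y2) *: m 'e_i3 'e_i2 + (x3 * y3) *: m 'e_i3 'e_i3.
  rewrite bilinear_rv3 !sum3 !rv3_entry m12 m21 m22 sq1 -!rv30 !rv3_delta.
  move: (m _ _) (m _ _) (m _ _) (m _ _) (m _ _) => A B U W G.
  by apply/rowP; apply: ord3P; rewrite !mxE /=; ring.
have lin13 := lin 'e_i1 'e_i3; have lin23 := lin 'e_i2 'e_i3; have lin31 := lin 'e_i3 'e_i1.
have cube3 := cube 'e_i3; rewrite sq1 m22 in lin13 lin23.
move: mE lin13 lin23 lin31 cube3.
rewrite (rv3_eta (m 'e_i1 'e_i3)) (rv3_eta (m 'e_i3 'e_i1)) (rv3_eta (m 'e_i2 'e_i3))
  (rv3_eta (m 'e_i3 'e_i2)) (rv3_eta (m 'e_i3 'e_i3)).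
move: (m 'e_i1 'e_i3 0 i1) (m 'e_i1 'e_i3 0 i2) (m 'e_i1 'e_i3 0 i3) => a1 a2 a3.
move: (m 'e_i3 'e_i1 0 i1) (m 'e_i3 'e_i1 0 i2) (m 'e_i3 'e_i1 0 i3) => b1 b2 b3.
move: (m 'e_i2 'e_i3 0 i1) (m 'e_i2 'e_i3 0 i2) (m 'e_i2 'e_i3 0 i3) => u1 u2 u3.
move: (m 'e_i3 'e_i2 0 i1) (m 'e_i3 'e_i2 0 i2) (m 'e_i3 'e_i2 0 i3) => w1 w2 w3.
move: (m 'e_i3 'e_i3 0 i1) (m 'e_i3 'e_i3 0 i2) (m 'e_i3 'e_i3 0 i3) => g1 g2 g3 mE.
rewrite -!rv30 !rv3_delta !rv3D !mE !(rv3Z, rv3D).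
move=> -[/rv3_inj[l1 l2 l3] /rv3_inj[l4 l5 l6]] -[/rv3_inj[_ _ n1] /rv3_inj[_ _ n2]].
move=> -[/rv3_inj[k1 k2 _] /rv3_inj[k3 k4 _]] -[/rv3_inj[_ _ c1] /rv3_inj[_ _ c2]].
have ? : u1 = - ((a3 + b3) * b1) by apply: subr0_eq; rewrite -[RHS]l1; ring.
have ? : u2 = - (a1 + b1) - (a3 + b3) * b2 by apply: subr0_eq; rewrite -[RHS]l2; ring.
have ? : u3 = - ((a3 + b3) * b3) by apply: subr0_eq; rewrite -[RHS]l3; ring.
have ? : w1 = - ((a3 + b3) * a1) by apply: subr0_eq; rewrite -[RHS]l4; ring.
have ? : w2 = - (a1 + b1) - (a3 + b3) * a2 by apply: subr0_eq; rewrite -[RHS]l5; ring.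
have ? : w3 = - ((a3 + b3) * a3) by apply: subr0_eq; rewrite -[RHS]l6; ring.
subst u1 u2 u3 w1 w2 w3.
(* The sum of the two identities at (e2, e3) is the fourth power of a3 + b3. *)
have s3 : a3 + b3 = 0.
  apply/eqP; rewrite -[_ == 0](@expf_eq0 _ _ 4); apply/eqP.
  by apply: (sum_eq0 n1 n2); ring.
have ? : b3 = - a3 by apply/eqP; rewrite -addr_eq0 addrC s3.
subst b3.
(* The sum of the two cubes of e3 has third coordinate 2 g3^2. *)
have g30 : g3 = 0.
  apply/eqP; rewrite -[_ == 0](@expf_eq0 _ _ 2) -(mulrI_eq0 _ (lregP two_neq0)).
  by apply/eqP; apply: (sum_eq0 c1 c2); ring.
subst g3.
(* The sum of the identities at (e3, e1) has first coordinate (a1 + b1)^2. *)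
have s1 : a1 + b1 = 0.
  apply/eqP; rewrite -[_ == 0](@expf_eq0 _ _ 2); apply/eqP.
  by apply: (sum_eq0 k1 k3); ring.
have ? : b1 = - a1 by apply/eqP; rewrite -addr_eq0 addrC s1.
subst b1.
have g10 : g1 = 0.
  apply/eqP; rewrite -(mulrI_eq0 _ (lregP two_neq0)); apply/eqP.
  by apply: (sum_eq0 k2 k4); ring.
subst g1; exists ((a2 + b2) / 2), g2, a1, ((a2 - b2) / 2), a3 => x y.
rewrite (rv3_eta x) (rv3_eta y) mE square_algE !(rv3Z, rv3D); congr rv3; field.
all: by rewrite ?two_neq0.
Qed.

(** The basis starts with x and xx. They are independent: if xx = k x then
    0 = x (xx) = k (xx), so k = 0 and xx = 0. *)
Lemma isomorphic_square_alg (V : vectType K) (mul : {bilinear V -> V -> V}) x :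
  \dim {:V} = 3%N -> cube_zero mul -> mul x x != 0 ->
  exists t r a b c, isomorphic mul (square_alg 1 t r a b c).
Proof.
move=> dimV cube xx0; pose n := mul x x.
have free_nx : free [:: n; x].
  rewrite free_cons seq1_free span_seq1; apply/andP; split; last first.
    by apply: contra_neq xx0 => ->; rewrite linear0l.
  apply/negP => /vlineP[k nE]; have /eqP := mul_sqr cube x.
  rewrite -/n nE linearZr_LR scaler_eq0 (negbTE xx0) orbF => /eqP k0.
  by move: xx0; rewrite -/n nE k0 scale0r eqxx.
have [y _ ynx] : exists2 y, y \in fullv & y \notin <<[:: n; x]>>%VS.
  apply/subvPn/negP => /dimvS; rewrite dimV leqNgt ltnS => /negP; apply.
  exact: dim_span.
have free_ynx : free [:: y; n; x] by rewrite free_cons ynx.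
pose b := [tuple x; n; y].
have bV : basis_of fullv b.
  rewrite basisEfree subvf dimV leqnn !andbT.
  by rewrite (perm_free (_ : perm_eq b (rev b))) // perm_sym perm_rev.
have bm := isomorphic_coord_alg mul bV.
have [t [r [a [c [d mE]]]]] : exists t r a b' c, forall x y,
    coord_alg mul b x y = square_alg 1 t r a b' c x y.
  apply: cube_zero_square_alg; first by apply/(cube_zero_isomorphic bm).
  rewrite coord_algE; apply/rowP => k; rewrite !mxE.
  by rewrite -[mul _ _]/(b`_i2) coord_free ?(basis_free bV) // eqxx eq_sym.
by exists t, r, a, c, d; apply: isomorphic_trans bm (isomorphic_eq mE).
Qed.

Lemma isomorphic_form_alg (V : vectType K) (mul : {bilinear V -> V -> V}) :
  \dim {:V} = 3%N -> (forall x, mul x x = 0) ->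
  exists M, isomorphic mul (form_alg M).
Proof.
move=> dimV alt; have [b bV] : exists b : 3.-tuple V, basis_of fullv b.
  by rewrite -dimV; exists (vbasis fullv); apply: vbasisP.
have [f [g fK gK] fM] := isomorphic_coord_alg mul bV.
have [M mE] : exists M, forall x y, coord_alg mul b x y = form_alg M x y.
  by apply: alternating_form_alg => x; rewrite -[x]gK -fM alt linear0.
by exists M; apply: isomorphic_trans (isomorphic_coord_alg mul bV) (isomorphic_eq mE).
Qed.

End StructureConstants.

(** * Bilinear forms up to congruence and scaling *)

Section ClassificationOfForms.
Context {C : numClosedFieldType}.
Implicit Types (p q r s t u v : C).

Definition classified (M : 'M[C]_3) : Prop :=
  congruent M 0 \/ exists2 s, anticommutative s & congruent M (form_of s).

Lemma classified_congruent M N : congruent M N -> classified N -> classified M.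
Proof.
move=> MN [N0 | [s sA Ns]]; first by left; apply: congruent_trans MN N0.
by right; exists s => //; apply: congruent_trans MN Ns.
Qed.

Definition block p q r s t : 'M[C]_3 := mx3 p q 0 r s 0 0 0 t.

(** Over an algebraically closed field each plane contains an isotropic vector,
    which is taken as the first basis vector. *)
Lemma block_isotropic p q r s t :
  exists q' r' s', (q' == r') = (q == r) /\ congruent (block p q r s t) (block 0 q' r' s' t).
Proof.
have [s0 | s0] := eqVneq s 0.
  exists r, q, p; split; first by rewrite eq_sym.
  exists (mx3 0 1 0 1 0 0 0 0 1), 1; split; rewrite ?oner_neq0 //.
    by simpl_det; rewrite oppr_eq0 oner_neq0.
  by rewrite s0 /block trmx3 !mx3M mx3Z; congr mx3; ring.
pose x := (- (q + r) + sqrtC ((q + r) ^+ 2 - 4 * p * s)) / (2 * s).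
have xP : p + (q + r) * x + s * x ^+ 2 = 0.
  rewrite /x; set d := sqrtC _; have dd : d ^+ 2 = (q + r) ^+ 2 - 4 * p * s by exact: sqrtCK.
  have -> : p = ((q + r) ^+ 2 - d ^+ 2) / (4 * s) by rewrite dd; field.
  by field.
exists (q + x * s), (r + x * s), s; split; first by rewrite (inj_eq (addIr _)).
exists (mx3 1 0 0 x 1 0 0 0 1), 1; split; rewrite ?oner_neq0 //.
  by simpl_det; rewrite oner_neq0.
rewrite /block trmx3 !mx3M mx3Z; congr mx3; try by ring.
by rewrite [RHS]mulr0 -[RHS]xP; ring.
Qed.

(** With e1 isotropic, the plane is determined by the ratio - q / r, which is the
    parameter of G3 or A1, except that s has to be distinguished from 0 when
    q + r = 0: adding a multiple of e1 to e2 changes s by a multiple of q + r.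
    When r = 0, the other isotropic line is used. *)
Lemma classified_nonsymmetric_block q r s t : q != r -> classified (block 0 q r s t).
Proof.
move=> qr; have q_r : q - r != 0 by rewrite subr_eq0.
have [/andP[/eqP rq /eqP s0] | hs] := boolP ((q + r == 0) && (s == 0)).
  have {}rq : r = - q by apply/eqP; rewrite -addr_eq0 addrC rq.
  have q0 : q != 0 by apply: contra_neq qr => q0; rewrite rq q0 oppr0.
  right; have [-> | t0] := eqVneq t 0.
    exists G2 => //; exists 1, q; split; rewrite ?det1 ?oner_neq0 //.
    by rewrite trmx1 mul1mx mulmx1 /block /= mx3Z rq s0; congr mx3; ring.
  exists A3 => //; exists (mx3 1 0 0 0 (t / q) 0 0 0 1), t; split => //.
    by simpl_det; rewrite mulf_neq0 ?invr_eq0.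
  by rewrite /block /= trmx3 !mx3M mx3Z rq s0; congr mx3; field.
wlog r0 : q r s qr q_r hs / r != 0.
  move=> IH; have [r0 | r0] := eqVneq r 0; last exact: (IH q r s).
  have q0 : q != 0 by rewrite r0 subr0 in q_r.
  have q0' : q - 0 != 0 by rewrite subr0.
  apply: (@classified_congruent _ (block 0 0 q 0 t)); last first.
    by apply: (IH 0 q 0); rewrite ?subr0 ?add0r ?sub0r ?oppr_eq0 // ?negb_and ?q0 // eq_sym.
  exists (mx3 (- s / q) 1 0 1 0 0 0 0 1), 1; split; rewrite ?oner_neq0 //.
    by simpl_det; rewrite oppr_eq0 oner_neq0.
  by rewrite /block trmx3 !mx3M mx3Z r0; congr mx3; field.
right; have [t0 | t0] := eqVneq t 0.
  exists (G3 (- q / r)) => //; have [qr0 | qr0] := eqVneq (q + r) 0.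
    have s0 : s != 0 by apply: contra hs => s0; rewrite qr0 eqxx.
    have {}rq : q = - r by apply/eqP; rewrite -addr_eq0 qr0.
    exists (mx3 (s / r) 0 0 0 1 0 0 0 1), (- s); rewrite oppr_eq0; split => //.
      by simpl_det; rewrite mulf_neq0 ?invr_eq0.
    by rewrite /block /= trmx3 !mx3M mx3Z rq t0; congr mx3; field.
  exists (mx3 1 ((r - s) / (q + r)) 0 0 1 0 0 0 1), (- r); rewrite oppr_eq0; split => //.
    by simpl_det; rewrite oner_neq0.
  by rewrite /block /= trmx3 !mx3M mx3Z t0; congr mx3; field; rewrite ?r0 ?qr0.
exists (A1 (- q / r)) => //; pose n := - q / (q - r).
(* A1 asks for a first vector k e1, a second one m e1 + z e2 + n e3 and a third
   one x e1 + e3; the coefficients n and x are forced by the products of the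
   second vector with the third, and mz makes the second one isotropic. *)
suff [k [m [z [k0 z0 kz mz]]]] : exists k m z : C, [/\ k != 0, z != 0,
    k * z * r = - t & s * z ^+ 2 + m * z * (q + r) + n ^+ 2 * t = 0].
  exists (mx3 k m (t / (z * (q - r))) 0 z 0 0 n 1), t; split => //.
    by simpl_det; rewrite mulf_neq0.
  have kE : k = - t / (z * r) by rewrite -kz; field; rewrite z0 r0.
  rewrite /block /= trmx3 !mx3M mx3Z; congr mx3; rewrite ?kE /n;
    try by field; rewrite ?r0 ?z0 ?q_r.
  by rewrite [RHS]mulr0 -[RHS]mz /n; field.
have [qr0 | qr0] := eqVneq (q + r) 0; last first.
  exists (- t / r), (- (s + n ^+ 2 * t) / (q + r)), 1; split; rewrite ?oner_neq0 //.
  - by rewrite mulf_neq0 ?invr_eq0 ?oppr_eq0.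
  - by field.
  - by field.
have s0 : s != 0 by apply: contra hs => s0; rewrite qr0 eqxx.
have {}rq : q = - r by apply/eqP; rewrite -addr_eq0 qr0.
have nE : n = - 2^-1.
  by rewrite /n rq; field; rewrite -opprD oppr_eq0 -mulr2n mulrn_eq0.
pose z := sqrtC (- t / (4 * s)).
have zz : z ^+ 2 = - t / (4 * s) by exact: sqrtCK.
have z0 : z != 0.
  by rewrite -sqrf_eq0 zz mulf_neq0 ?oppr_eq0 ?invr_eq0 // mulf_neq0 // pnatr_eq0.
exists (- t / (z * r)), 0, z; split => //.
- by rewrite mulf_neq0 ?oppr_eq0 ?invr_eq0 // mulf_neq0.
- by field; rewrite z0 r0.
- by rewrite zz nE; field.
Qed.

(** A symmetric form is known by its rank; the explicit vectors are
    orthogonal ones for rank 3 and isotropic ones for rank 2. *)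
Lemma classified_symmetric_block q s t : t != 0 -> classified (block 0 q q s t).
Proof.
move=> t0; right; have [q0 | q0] := eqVneq q 0; last first.
  exists G4 => //.
  exists (mx3 ((t - s / 4) / q) ('i * ((t + s / 4) / q)) 0 2^-1 (- 'i / 2) 0 0 0 1), t.
  split => //; last first.
    have i2 : 'i * 'i = -1 :> C by rewrite -expr2 sqrCi.
    by rewrite /block /= trmx3 !mx3M mx3Z; congr mx3; field: i2.
  have -> : \det (mx3 ((t - s / 4) / q) ('i * ((t + s / 4) / q)) 0
                      2^-1 (- 'i / 2) 0 0 0 1) = - 'i * (t / q).
    by rewrite det_mx3; field.
  by rewrite !mulf_neq0 ?oppr_eq0 ?invr_eq0 ?neq0Ci.
have [s0 | s0] := eqVneq s 0.
  exists G1 => //; exists (mx3 0 0 1 0 1 0 1 0 0), t; split => //.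
    by simpl_det; rewrite oppr_eq0 oner_neq0.
  by rewrite /block /= trmx3 !mx3M mx3Z q0 s0; congr mx3; ring.
(* The vector w e2 + e3 is isotropic, as the first vector of G3 has to be. *)
pose w := sqrtC (- t / s).
have ww : w ^+ 2 = - t / s by exact: sqrtCK.
have w0 : w != 0 by rewrite -sqrf_eq0 ww mulf_neq0 ?oppr_eq0 ?invr_eq0.
exists (G3 (- 1)) => //; exists (mx3 0 0 1 w 0 0 1 1 0), (- t); split; rewrite ?oppr_eq0 //.
  by simpl_det.
rewrite /block /= trmx3 !mx3M mx3Z q0; congr mx3; try by ring.
rewrite [RHS]mulr0; transitivity (w ^+ 2 * s + t); first by ring.
by rewrite ww; field.
Qed.

Lemma classified_block p q r s t : (q == r) ==> (t != 0) -> classified (block p q r s t).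
Proof.
move=> hqr; have [q' [r' [s' [E]]]] := block_isotropic p q r s t.
move/classified_congruent; apply; have [qr | qr] := eqVneq q r; last first.
  by apply: classified_nonsymmetric_block; rewrite E.
have /eqP -> : q' == r' by rewrite E qr.
by apply: classified_symmetric_block; rewrite qr eqxx in hqr.
Qed.

(** The line of e3 is nonisotropic and both of its orthogonals agree, so it
    splits off. *)
Lemma classified_corner p q r s u v t :
  t != 0 -> classified (mx3 p q u r s v u v t).
Proof.
move=> t0; pose b x y z := z - x * y / t.
apply: (@classified_congruent _ (block (b u u p) (b u v q) (b u v r) (b v v s) t)).
  exists (mx3 1 0 0 0 1 0 (- u / t) (- v / t) 1), 1; split; rewrite ?oner_neq0 //.
    by simpl_det; rewrite oner_neq0.
  by rewrite /b /block trmx3 !mx3M mx3Z; congr mx3; field.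
by apply: classified_block; rewrite t0 implybT.
Qed.

(** Here e3 spans the kernel of the skew part and is isotropic, but not orthogonal
    to everything. Successive changes of basis reach u = 0, then r = - q and s = 0;
    the only alternative that remains is whether p vanishes. *)
Lemma classified_isotropic_kernel p q r s u v :
  q != r -> (u != 0) || (v != 0) -> classified (mx3 p q u r s v u v 0).
Proof.
wlog v0 : p q r s u v / v != 0.
  move=> IH qr uv; have [v0 | v0] := eqVneq v 0; last exact: IH.
  rewrite v0 eqxx orbF in uv.
  apply: (@classified_congruent _ (mx3 s r v q p u v u 0)); last first.
    by apply: IH; rewrite ?uv ?orbT // eq_sym.
  exists (mx3 0 1 0 1 0 0 0 0 1), 1; split; rewrite ?oner_neq0 //.
    by simpl_det; rewrite oppr_eq0 oner_neq0.
  by rewrite trmx3 !mx3M mx3Z; congr mx3; ring.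
wlog u0 : p q r s u / u = 0.
  move=> IH qr _; pose x := u / v.
  apply: (@classified_congruent _ (mx3 (p - x * (q + r) + x ^+ 2 * s) (q - x * s) 0
                                      (r - x * s) s v 0 v 0)); last first.
    by apply: IH; rewrite ?v0 ?orbT // (inj_eq (addIr _)).
  exists (mx3 1 0 0 (- x) 1 0 0 0 1), 1; split; rewrite ?oner_neq0 //.
    by simpl_det; rewrite oner_neq0.
  by rewrite /x trmx3 !mx3M mx3Z; congr mx3; field.
rewrite {}u0 => qr _.
(* Adding a multiple of e3 to e1 shifts q and r alike, and adding one to e2
   shifts s. *)
wlog [rq s0] : p q r s qr / r = - q /\ s = 0.
  move=> IH; pose d := (q - r) / 2.
  have qr0 : q - r != 0 by rewrite subr_eq0.
  have d0 : d != 0 by rewrite mulf_neq0 ?invr_eq0 ?pnatr_eq0.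
  pose l := - (q + r) / (2 * v).
  apply: (@classified_congruent _ (mx3 p d 0 (- d) 0 v 0 v 0)); last first.
    apply: IH => //; rewrite -subr_eq0 opprK -mulr2n mulrn_eq0 //.
  exists (mx3 1 0 0 0 1 0 l (- s / (2 * v)) 1), 1; split; rewrite ?oner_neq0 //.
    by simpl_det; rewrite oner_neq0.
  by rewrite /l /d trmx3 !mx3M mx3Z; congr mx3; field.
have q0 : q != 0 by apply: contra_neq qr => q0; rewrite rq q0 oppr0.
rewrite {}rq {}s0; right; have [-> | p0] := eqVneq p 0.
  exists A2 => //; exists (mx3 0 (- v) v 1 0 0 0 q q), (2 * q * v); split.
  - have -> : \det (mx3 0 (- v) v 1 0 0 0 q q) = 2 * q * v by rewrite det_mx3; ring.
    by rewrite !mulf_neq0 // pnatr_eq0.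
  - by rewrite !mulf_neq0 // pnatr_eq0.
  - by rewrite /= trmx3 !mx3M mx3Z; congr mx3; ring.
pose z := p / (2 * q).
have z0 : z != 0 by rewrite !mulf_neq0 ?invr_eq0 ?mulf_neq0 // pnatr_eq0.
exists (A1 (- 1)) => //; exists (mx3 0 0 1 0 z 0 (- 2 * q / v) 0 (- q / v)), p; split => //.
  have -> : \det (mx3 0 0 1 0 z 0 (- 2 * q / v) 0 (- q / v)) = 2 * q * z / v.
    by rewrite det_mx3; field.
  by rewrite mulf_neq0 ?invr_eq0 // mulf_neq0 // mulf_neq0 // pnatr_eq0.
by rewrite /z /= trmx3 !mx3M mx3Z; congr mx3; field; rewrite ?q0 ?v0.
Qed.

Lemma classified_skew_kernel p q r s u v t :
  q != r -> classified (mx3 p q u r s v u v t).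
Proof.
move=> qr; have [t0 | /classified_corner //] := eqVneq t 0.
have [uv | ] := boolP ((u != 0) || (v != 0)).
  by rewrite t0; apply: classified_isotropic_kernel.
rewrite negb_or !negbK => /andP[/eqP -> /eqP ->].
by apply: classified_block; rewrite (negbTE qr).
Qed.

(** Unless the form is zero, some combination of basis vectors is nonisotropic and
    can be taken as the third basis vector. *)
Lemma classified_symmetric p q s u v t : classified (mx3 p q u q s v u v t).
Proof.
have [t0 | /classified_corner //] := eqVneq t 0.
have use M P p' q' s' u' v' t' : t' != 0 -> \det P != 0 ->
    P^T *m M *m P = mx3 p' q' u' q' s' v' u' v' t' -> classified M.
  move=> t'0 P0 PM; apply: classified_congruent (classified_corner p' q' q' s' u' v' t'0).
  by exists P, 1; rewrite scale1r oner_neq0.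
have [s0 | s0] := eqVneq s 0; last first.
  apply: (use _ (mx3 1 0 0 0 0 1 0 1 0) p u t q v s s0).
    by simpl_det; rewrite oppr_eq0 oner_neq0.
  by rewrite trmx3 !mx3M; congr mx3; ring.
have [p0 | p0] := eqVneq p 0; last first.
  apply: (use _ (mx3 0 0 1 0 1 0 1 0 0) t v s u q p p0).
    by simpl_det; rewrite oppr_eq0 oner_neq0.
  by rewrite trmx3 !mx3M; congr mx3; ring.
rewrite {}t0 {}s0 {}p0; have two x : x != 0 -> 2 * x != 0 :> C.
  by move=> x0; rewrite mulf_neq0 // pnatr_eq0.
have [u0 | /two u0] := eqVneq u 0; last first.
  apply: (use _ (mx3 1 0 1 0 1 0 0 0 1) 0 q 0 u (q + v) (2 * u) u0).
    by simpl_det; rewrite oner_neq0.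
  by rewrite trmx3 !mx3M; congr mx3; ring.
have [v0 | /two v0] := eqVneq v 0; last first.
  apply: (use _ (mx3 1 0 0 0 1 1 0 0 1) 0 q 0 (q + u) v (2 * v) v0).
    by simpl_det; rewrite oner_neq0.
  by rewrite trmx3 !mx3M; congr mx3; ring.
have [q0 | /two q0] := eqVneq q 0; last first.
  apply: (use _ (mx3 0 1 1 0 0 1 1 0 0) 0 u 0 (u + v) q (2 * q) q0).
    by simpl_det; rewrite oner_neq0.
  by rewrite trmx3 !mx3M; congr mx3; ring.
left; exists 1, 1; rewrite det1 oner_neq0 trmx1 mul1mx mulmx1 scaler0; split => //.
by rewrite u0 v0 q0; apply/matrixP; apply: ord3P; apply: ord3P; rewrite !mxE.
Qed.

(** If M is not symmetric, the kernel (a1, a2, a3) of its skew part is completed to a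
    basis by two vectors of the standard one. *)
Theorem forms_classified (M : 'M[C]_3) : classified M.
Proof.
rewrite (mx3_eta M); move: (M i1 i1) (M i1 i2) (M i1 i3) (M i2 i1) (M i2 i2) (M i2 i3)
  (M i3 i1) (M i3 i2) (M i3 i3) => m11 m12 m13 m21 m22 m23 m31 m32 m33.
pose a1 := m23 - m32; pose a2 := m31 - m13; pose a3 := m12 - m21.
set M' := mx3 _ _ _ _ _ _ _ _ _.
have use P (N := P^T *m M' *m P) : \det P != 0 -> N i1 i2 - N i2 i1 != 0 ->
    N i3 i1 = N i1 i3 -> N i3 i2 = N i2 i3 -> classified M'.
  rewrite subr_eq0 => P0 N12 N13 N23.
  apply: (classified_congruent (N := N)); first by exists P, 1; rewrite scale1r oner_neq0.
  by rewrite (mx3_eta N) N13 N23; apply: classified_skew_kernel.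
have [a30 | a30] := eqVneq a3 0; last first.
  apply: (use (mx3 1 0 a1 0 1 a2 0 0 a3)); first by simpl_det.
  - by apply: contra_neq a30; rewrite trmx3 !mx3M !mxE /= => <-; rewrite /a3; ring.
  - by rewrite trmx3 !mx3M !mxE /= /a1 /a2 /a3; ring.
  - by rewrite trmx3 !mx3M !mxE /= /a1 /a2 /a3; ring.
have [a20 | a20] := eqVneq a2 0; last first.
  apply: (use (mx3 0 1 a1 0 0 a2 1 0 a3)); first by simpl_det.
  - by apply: contra_neq a20; rewrite trmx3 !mx3M !mxE /= => <-; rewrite /a2; ring.
  - by rewrite trmx3 !mx3M !mxE /= /a1 /a2 /a3; ring.
  - by rewrite trmx3 !mx3M !mxE /= /a1 /a2 /a3; ring.
have [a10 | a10] := eqVneq a1 0; last first.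
  apply: (use (mx3 0 0 a1 1 0 a2 0 1 a3)); first by simpl_det.
  - by apply: contra_neq a10; rewrite trmx3 !mx3M !mxE /= => <-; rewrite /a1; ring.
  - by rewrite trmx3 !mx3M !mxE /= /a1 /a2 /a3; ring.
  - by rewrite trmx3 !mx3M !mxE /= /a1 /a2 /a3; ring.
rewrite /M' {use}.
move/subr0_eq: a10 => ->; move/subr0_eq: a20 => ->; move/subr0_eq: a30 => ->.
exact: classified_symmetric.
Qed.

End ClassificationOfForms.

(** * Normal forms of the algebras with a line of squares *)

Section NewBases.
Context {K : fieldType}.

(** The rows of [Q] are the new basis, in the coordinates of the source. *)
Lemma isomorphic_new_basis (m m' : {bilinear 'rV[K]_3 -> 'rV[K]_3 -> 'rV[K]_3}) (Q : 'M[K]_3) :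
  \det Q != 0 -> (forall x y, m (x *m Q) (y *m Q) = m' x y *m Q) -> isomorphic m m'.
Proof.
move=> dQ QM; have Qu : Q \in unitmx by rewrite unitmxE unitfE.
apply: (@isomorphic_mx _ _ _ (invmx Q)) => [|x y].
  by rewrite det_inv invr_eq0.
by rewrite -{1}[x](mulmxKV Qu) -{1}[y](mulmxKV Qu) QM mulmxK.
Qed.

Lemma square_alg_new_basis p t r a b c p' t' r' a' b' c' (Q : 'M[K]_3) :
  \det Q != 0 ->
  (forall x1 x2 x3 y1 y2 y3,
     square_alg p t r a b c (rv3 x1 x2 x3 *m Q) (rv3 y1 y2 y3 *m Q) =
     square_alg p' t' r' a' b' c' (rv3 x1 x2 x3) (rv3 y1 y2 y3) *m Q) ->
  isomorphic (square_alg p t r a b c) (square_alg p' t' r' a' b' c').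
Proof.
move=> dQ QM; apply: (isomorphic_new_basis dQ) => x y.
by rewrite (rv3_eta x) (rv3_eta y).
Qed.

End NewBases.

Section NormalFormsOfSquares.
Context {C : numClosedFieldType}.
Implicit Types t r a b c : C.

Definition listed (m : {bilinear 'rV[C]_3 -> 'rV[C]_3 -> 'rV[C]_3}) : Prop :=
  (exists s : name C, isomorphic m (alg s)) \/ isomorphic m missing_alg.

Lemma listed_isomorphic m m' : isomorphic m m' -> listed m' -> listed m.
Proof.
move=> mm' [[s ms] | mm]; [left; exists s | right].
  exact: isomorphic_trans mm' ms.
exact: isomorphic_trans mm' mm.
Qed.

Lemma listed_square_of s : ~~ anticommutative s -> listed (square_of s).
Proof. by move=> sN; left; exists s; apply: isomorphic_eq => x y; rewrite alg_square. Qed.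

(** The quadratic form is x1^2, with radical spanned by e2 and e3: the cases are w
    outside the radical (N2), in the radical but not a multiple of e2 (N3), a nonzero multiple of e2
    (N4), and zero (N1). *)
Lemma listed_square_rank1 a b c : listed (square_alg 1 0 0 a b c).
Proof.
have [a0 | a0] := eqVneq a 0; last first.
  apply: (listed_isomorphic _ (@listed_square_of N2 isT)).
  apply: (@square_alg_new_basis _ _ _ _ _ _ _ _ _ _ _ _ _
            (mx3 1 (b / a) (c / a) 0 1 0 0 0 a^-1)).
    by simpl_det; rewrite invr_eq0.
  by move=> *; rewrite !rv3M !square_algE rv3M; congr rv3; field.
have [c0 | c0] := eqVneq c 0; last first.
  apply: (listed_isomorphic _ (@listed_square_of N3 isT)).
  apply: (@square_alg_new_basis _ _ _ _ _ _ _ _ _ _ _ _ _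
            (mx3 c^-1 0 0 0 (c^-1 ^+ 2) 0 0 (b / c) 1)).
    by simpl_det; rewrite mulf_neq0 ?expf_neq0 ?invr_eq0.
  by move=> *; rewrite a0 !rv3M !square_algE rv3M; congr rv3; field.
rewrite a0 c0; have [-> | b0] := eqVneq b 0.
  exact: (@listed_square_of N1 isT).
apply: (listed_isomorphic _ (@listed_square_of N4 isT)).
apply: (@square_alg_new_basis _ _ _ _ _ _ _ _ _ _ _ _ _ (mx3 1 0 0 0 1 0 0 0 b^-1)).
  by simpl_det; rewrite invr_eq0.
by move=> *; rewrite !rv3M !square_algE rv3M; congr rv3; field.
Qed.

(** The quadratic form is x1^2 + x3^2. A nonisotropic w becomes the third basis
    vector of N5, after scaling by 1 / (a^2 + c^2); an isotropic w which is not a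
    multiple of e2 becomes the first basis vector of the missing algebra. *)
Lemma listed_square_rank2 a b c : listed (square_alg 1 0 1 a b c).
Proof.
have [d0 | d0] := eqVneq (a ^+ 2 + c ^+ 2) 0; last first.
  set d := _ + _ in d0; apply: (listed_isomorphic _ (@listed_square_of N5 isT)).
  apply: (@square_alg_new_basis _ _ _ _ _ _ _ _ _ _ _ _ _
            (mx3 (c / d) 0 (- a / d) 0 d^-1 0 (a / d) (b / d) (c / d))).
    have -> : \det (mx3 (c / d) 0 (- a / d) 0 d^-1 0 (a / d) (b / d) (c / d)) = d^-1 ^+ 2.
      by rewrite det_mx3 /d; field.
    by rewrite expf_neq0 // invr_eq0.
  by move=> *; rewrite !rv3M !square_algE rv3M /d; congr rv3; field.
have [a0 | a0] := eqVneq a 0.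
  have -> : c = 0 by apply/eqP; rewrite -sqrf_eq0 -d0 a0 expr0n add0r.
  by rewrite a0; apply: (@listed_square_of (N6 b) isT).
(* A square root of -1; the second isotropic line is spanned by a e1 - c e3. *)
pose e := c / a; have ee : e * e = - 1.
  have cc : c ^+ 2 = - a ^+ 2 by apply/eqP; rewrite -addr_eq0 addrC d0.
  by rewrite /e mulf_div -!expr2 cc; field.
have -> : c = e * a by rewrite /e; field.
have e0 : e != 0 by apply: contra_eq_neq ee => ->; rewrite mul0r eq_sym oppr_eq0 oner_neq0.
apply: (@listed_isomorphic _ (square_alg 0 1 0 1 0 0)); last first.
  by right; apply: isomorphic_eq => x y; rewrite missing_alg_square.
apply: (@square_alg_new_basis _ _ _ _ _ _ _ _ _ _ _ _ _
          (mx3 a b (e * a) 0 e 0 (e / (2 * a)) 0 ((2 * a)^-1))).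
  have -> : \det (mx3 a b (e * a) 0 e 0 (e / (2 * a)) 0 ((2 * a)^-1)) = e.
    by rewrite det_mx3; field: ee.
  by [].
by move=> *; rewrite !rv3M !square_algE rv3M; congr rv3; field: ee.
Qed.

(** Subtracting t e1 from e3 makes q diagonal. *)
Lemma listed_square t r a b c : listed (square_alg 1 t r a b c).
Proof.
pose r' := r - t ^+ 2; apply: (@listed_isomorphic _ (square_alg 1 0 r' (a + c * t) b c)).
  apply: (@square_alg_new_basis _ _ _ _ _ _ _ _ _ _ _ _ _ (mx3 1 0 0 0 1 0 (- t) 0 1)).
    by simpl_det; rewrite oner_neq0.
  by move=> *; rewrite !rv3M !square_algE rv3M /r'; congr rv3; ring.
have [-> | r0] := eqVneq r' 0; first exact: listed_square_rank1.
move: (a + c * t) => {}a; pose k := sqrtC r'.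
have kk : r' = k ^+ 2 by rewrite sqrtCK.
have k0 : k != 0 by rewrite sqrtC_eq0.
apply: listed_isomorphic (listed_square_rank2 (a / k) (b / k) c).
apply: (@square_alg_new_basis _ _ _ _ _ _ _ _ _ _ _ _ _ (mx3 1 0 0 0 1 0 0 0 k^-1)).
  by simpl_det; rewrite invr_eq0.
by move=> *; rewrite !rv3M !square_algE rv3M kk; congr rv3; field.
Qed.

End NormalFormsOfSquares.

(** * Invariants of the alternating algebras *)

Section Invariants.
Context {C : numClosedFieldType}.
Implicit Types (M N P : 'M[C]_3).

(** The vector that represents the skew part of M; it spans its kernel when that
    part is nonzero. *)
Definition axis M : 'rV[C]_3 :=
  rv3 (M i2 i3 - M i3 i2) (M i3 i1 - M i1 i3) (M i1 i2 - M i2 i1).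

(** Twice the symmetric part. *)
Definition symm M : 'M[C]_3 := M + M^T.

Lemma axis_congruent P M : axis (P^T *m M *m P) = axis M *m (\adj P)^T.
Proof.
rewrite (mx3_eta M) (mx3_eta P) adj_mx3 !trmx3 !mx3M /axis rv3M !mxE /=.
by congr rv3; ring.
Qed.

Section Isomorphic.
Context (P M N : 'M[C]_3).
Hypotheses (P0 : \det P != 0) (PM : P^T *m M *m P = \det P *: N).

Lemma axis_isomorphic : axis M = axis N *m P^T.
Proof.
have E : axis M *m (\adj P)^T = \det P *: axis N.
  by rewrite -axis_congruent PM /axis !mxE rv3Z; congr rv3; ring.
apply: (scalerI P0); rewrite scalemxAl -E -mulmxA -trmx_mul.
by rewrite mul_mx_adj tr_scalar_mx mul_mx_scalar.
Qed.

Lemma symm_isomorphic : P^T *m symm M *m P = \det P *: symm N.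
Proof.
rewrite /symm mulmxDr mulmxDl scalerDr PM; congr (_ + _).
have := congr1 trmx PM; rewrite !trmx_mul trmxK mulmxA => ->.
by rewrite linearZ.
Qed.

Lemma adj_symm_isomorphic : \adj (symm M) = P *m \adj (symm N) *m P^T.
Proof.
have := congr1 (fun A => P *m \adj A *m P^T) symm_isomorphic.
rewrite [\adj (_ *: _)]adjZ /= !adj_mulmx3 !mulmxA mul_mx_adj mul_scalar_mx.
rewrite -!mulmxA -trmx_adj -trmx_mul mul_mx_adj tr_scalar_mx mul_mx_scalar.
rewrite -scalemxAl -scalemxAr scalerA -expr2 !mulmxA.
by apply: scalerI; rewrite expf_neq0.
Qed.

Lemma det_symm_isomorphic : \det (symm M) = \det P * \det (symm N).
Proof.
apply: (mulfI (expf_neq0 2 P0)); have := congr1 determinant symm_isomorphic.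
by rewrite detZ !det_mulmx det_tr mulrA -exprSr => <-; ring.
Qed.

Lemma axis_value_isomorphic :
  axis M *m symm M *m (axis M)^T = \det P *: (axis N *m symm N *m (axis N)^T).
Proof.
have -> : axis M *m symm M *m (axis M)^T = axis N *m (P^T *m symm M *m P) *m (axis N)^T.
  by rewrite axis_isomorphic trmx_mul trmxK !mulmxA.
by rewrite symm_isomorphic -scalemxAr -scalemxAl.
Qed.

(** With S twice the symmetric part and a the axis: whether a = 0, S = 0, S has rank at
    most 1, S a = 0, and both det S and S a a are zero. *)
Definition form_invariant M :=
  (axis M == 0, symm M == 0, \adj (symm M) == 0, axis M *m symm M == 0,
   (\det (symm M) == 0) && (axis M *m symm M *m (axis M)^T == 0)).

Lemma form_invariant_isomorphic : form_invariant M = form_invariant N.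
Proof.
have Pu : P \in unitmx by rewrite unitmxE unitfE.
have PTu : P^T \in unitmx by rewrite unitmx_tr.
have mulr_eq0 n (A : 'M[C]_(n, 3)) Q : Q \in unitmx -> (A *m Q == 0) = (A == 0).
  by move=> Qu; rewrite -[RHS](inj_eq (can_inj (mulmxK Qu))) mul0mx.
have mull_eq0 n (A : 'M[C]_(3, n)) Q : Q \in unitmx -> (Q *m A == 0) = (A == 0).
  by move=> Qu; rewrite -[RHS](inj_eq (can_inj (mulKmx Qu))) mulmx0.
have scale_eq0 m n (A : 'M[C]_(m, n)) : (\det P *: A == 0) = (A == 0).
  by rewrite scaler_eq0 (negbTE P0).
rewrite /form_invariant det_symm_isomorphic axis_value_isomorphic scale_eq0.
rewrite mulf_eq0 (negbTE P0) adj_symm_isomorphic (mulr_eq0 _ _ _ PTu) (mull_eq0 _ _ _ Pu).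
rewrite -[symm M == 0](mull_eq0 _ _ _ PTu) -[P^T *m symm M == 0](mulr_eq0 _ _ _ Pu).
rewrite symm_isomorphic scale_eq0.
rewrite -[_ *m symm M == 0](mulr_eq0 _ _ _ Pu) axis_isomorphic -!mulmxA (mulmxA P^T).
by rewrite symm_isomorphic -scalemxAr scale_eq0 (mulr_eq0 _ _ _ PTu).
Qed.

End Isomorphic.

Lemma form_invariantE (s : name C) : anticommutative s ->
  form_invariant (form_of s) =
  match s with
  | G1 => (true, false, true, true, true)
  | G2 => (false, true, true, true, true)
  | G3 a => (a == - 1, false, a == 1, true, true)
  | G4 => (true, false, false, true, false)
  | A1 a => (false, false, false, false, false)
  | A2 => (false, false, false, false, true)
  | A3 => (false, false, true, false, false)
  | _ => (false, false, false, false, false)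
  end.
Proof.
have two0 : (1 + 1 == 0 :> C) = false by rewrite -(natrD _ 1 1) pnatr_eq0.
have one0 : (1 == 0 :> C) = false by rewrite oner_eq0.
case: s => [||a||a||||||||a] //= _; rewrite /form_invariant /symm !trmx3 !mx3D /axis
  !mxE /= adj_mx3 det_mx3 !rv3M rv3_dot !mx3_eq0 !rv3_eq0.
all: rewrite ?(oppr0, add0r, addr0, sub0r, subr0, mul0r, mulr0, mul1r, mulr1, mulN1r,
  mulrN1, opprK, subrr, addNr, oppr_eq0, eqxx, one0, two0, andbT, andbF) //=.
- rewrite addr_eq0 mulf_eq0 [-1 + a]addrC subr_eq0 orbb.
  by rewrite -[- 1 - 1]opprD oppr_eq0 two0 !andbF.
- by rewrite !mulf_eq0 two0.
- rewrite !mulf_eq0 two0 !orbF [-1 + a]addrC !orbb.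
  have [a1 | ] := eqVneq (a + 1) 0; last by rewrite !andbF.
  have -> : a - 1 = - (1 + 1) by apply: subr0_eq; rewrite -[RHS]a1; ring.
  by rewrite a1 subr0 opprK oppr_eq0 two0.
- by rewrite !mulf_eq0 two0.
Qed.

(** The equations give 4 d (b - a) (b a - 1) = 0. *)
Lemma inverse_parameters (a b d : C) :
  d * (b + 1) ^+ 2 = (a + 1) ^+ 2 -> d * (b - 1) ^+ 2 = (a - 1) ^+ 2 -> d != 0 ->
  a = b \/ a != 0 /\ b = a^-1.
Proof.
move=> E1 E2 d0.
have : (b - a) * (b * a - 1) == 0.
  have four0 : 4%:R != 0 :> C by rewrite pnatr_eq0.
  rewrite -(mulrI_eq0 _ (lregP four0)) -(mulrI_eq0 _ (lregP d0)).
  have -> : d * (4%:R * ((b - a) * (b * a - 1))) =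
            (a + 1) ^+ 2 * (d * (b - 1) ^+ 2) - (a - 1) ^+ 2 * (d * (b + 1) ^+ 2).
    by ring.
  by rewrite E1 E2 mulrC subrr.
rewrite mulf_eq0 => /orP[]; first by rewrite subr_eq0 => /eqP ->; left.
rewrite subr_eq0 => /eqP ba; right; have a0 : a != 0.
  by apply: contra_eq_neq ba => ->; rewrite mulr0 eq_sym oner_neq0.
by split=> //; rewrite -[b](mulfK a0) ba mul1r.
Qed.

(** Both the axis and the adjugate of the symmetric part are supported by the third
    coordinate: (b + 1) in the first case and - (b - 1)^2 in the second one, so the
    last entry p of P gives the common factor p^2. *)
Lemma G3_isomorphic (a b : C) :
  isomorphic (form_alg (form_of (G3 a))) (form_alg (form_of (G3 b))) ->
  a = b \/ a != 0 /\ b = a^-1.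
Proof.
have axisE c : axis (form_of (G3 c)) = rv3 0 0 (c + 1).
  by rewrite /axis !mxE /=; congr rv3; ring.
have adjE c : \adj (symm (form_of (G3 c))) = mx3 0 0 0 0 0 0 0 0 (- (c - 1) ^+ 2).
  by rewrite /symm trmx3 mx3D adj_mx3; congr mx3; ring.
case/form_alg_isomorphic => P P0 PM.
have := axis_isomorphic P0 PM; have := adj_symm_isomorphic P0 PM.
rewrite !axisE !adjE (mx3_eta P); move: (P i3 i3) => p; rewrite trmx3 !mx3M rv3M.
move/matrixP/(_ i3 i3); rewrite !mxE /= => E /rv3_inj[_ _ A].
have A1 : p ^+ 2 * (b + 1) ^+ 2 = (a + 1) ^+ 2 by rewrite A; ring.
have A2 : p ^+ 2 * (b - 1) ^+ 2 = (a - 1) ^+ 2 by apply: oppr_inj; rewrite E; ring.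
apply: (inverse_parameters A1 A2); apply: contraNneq (_ : 2%:R != 0 :> C) => [p0|]; last first.
  by rewrite pnatr_eq0.
have -> : 2%:R = (a + 1) - (a - 1) by ring.
move: A1 A2; rewrite p0 !mul0r => /esym/eqP; rewrite sqrf_eq0 => /eqP -> /esym/eqP.
by rewrite sqrf_eq0 => /eqP ->; rewrite subrr.
Qed.

(** The determinant of P is the common factor of det S and of the value of S at
    the axis. *)
Lemma A1_isomorphic (a b : C) :
  isomorphic (form_alg (form_of (A1 a))) (form_alg (form_of (A1 b))) ->
  a = b \/ a != 0 /\ b = a^-1.
Proof.
have detE c : \det (symm (form_of (A1 c))) = - 2 * (c - 1) ^+ 2.
  by rewrite /symm trmx3 mx3D det_mx3; ring.
have valueE c (M := form_of (A1 c)) :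
    (axis M *m symm M *m (axis M)^T) 0 0 = 2 * (c + 1) ^+ 2.
  by rewrite /symm /axis !mxE /= trmx3 mx3D rv3M sum3 !mxE /=; ring.
case/form_alg_isomorphic => P P0 PM.
have two0 : 2 != 0 :> C by rewrite pnatr_eq0.
have := det_symm_isomorphic P0 PM; rewrite !detE => D.
have := congr1 (fun A : 'M_1 => A 0 0) (axis_value_isomorphic P0 PM).
rewrite valueE mxE valueE => A.
apply: (@inverse_parameters _ _ (\det P)) => //; apply: (mulfI two0).
  by rewrite A; ring.
by apply: oppr_inj; rewrite -!mulNr D; ring.
Qed.

End Invariants.

(** * Exceptional isomorphisms *)

Section ExceptionalIsomorphisms.
Context {C : numClosedFieldType}.

(** The plane has two isotropic lines when a is not 1, and exchanging them inverts
    the parameter. *)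
Lemma G3_inv (a : C) : a != 0 -> congruent (form_of (G3 a)) (form_of (G3 a^-1)).
Proof.
move=> a0; have [-> | ] := eqVneq a 1; first by rewrite invr1; apply: congruent_refl.
rewrite -subr_eq0 => a1; pose P : 'M[C]_3 :=
  mx3 (a - 1)^-1 (- a^-1 + a / (a - 1) ^+ 2) 0 1 (a / (a - 1)) 0 0 0 1.
exists P, 1; split; rewrite ?oner_neq0 //.
  have -> : \det P = a^-1 by rewrite det_mx3; field; rewrite a0 a1.
  by rewrite invr_eq0.
by rewrite /= trmx3 !mx3M mx3Z; congr mx3; field; rewrite ?a0 ?a1.
Qed.

(** When a^2 is not 1, the line of the axis e1 - (a + 1) e3 splits off; the two
    isotropic lines of its orthogonal plane are exchanged as in [G3_inv]. *)
Lemma A1_inv (a : C) : a != 0 -> congruent (form_of (A1 a)) (form_of (A1 a^-1)).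
Proof.
move=> a0; have [-> | ] := eqVneq a 1; first by rewrite invr1; apply: congruent_refl.
rewrite -subr_eq0 => a1; have [-> | ] := eqVneq a (-1).
  by rewrite invrN invr1; apply: congruent_refl.
rewrite -subr_eq0 opprK => a2; pose m := a / ((a - 1) * (a + 1) ^+ 2).
pose P : 'M[C]_3 :=
  mx3 m (- a^-1 + m ^+ 2 + (a + 1) ^- 2) ((a * m - 1) / (a + 1))
      1 m (a / (a + 1))
      (a / (a + 1)) (m * (a / (a + 1)) - (a + 1)^-1) ((a * (a / (a + 1)) + (a + 1)) / (a + 1)).
have PA : P^T *m form_of (A1 a) *m P = 1 *: form_of (A1 a^-1).
  by rewrite /P /m /= trmx3 !mx3M mx3Z; congr mx3; field; rewrite ?a0 ?a1 ?a2.
exists P, 1; split; rewrite ?oner_neq0 //.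
(* P is invertible because it produces a nondegenerate form. *)
have : \det (form_of (A1 a^-1)) != 0.
  have -> : \det (form_of (A1 a^-1)) = a^-1 by rewrite det_mx3; ring.
  by rewrite invr_eq0.
by apply: contra_neq => P0; rewrite -[form_of _]scale1r -PA det_mulmx P0 mulr0.
Qed.

Lemma N6_opp (a : C) : isomorphic (alg (N6 a)) (alg (N6 (- a))).
Proof.
apply: (isomorphic_mx (P := mx3 1 0 0 0 1 0 0 0 (- 1))).
  by simpl_det; rewrite oppr_eq0 oner_neq0.
move=> x y; rewrite (rv3_eta x) (rv3_eta y) !rv3M !alg_square // !square_algE rv3M.
by congr rv3; ring.
Qed.

Lemma exceptional_isomorphic (s t : name C) :
  exceptional_pair s t -> isomorphic (alg s) (alg t).
Proof.
have form u v : anticommutative u -> anticommutative v ->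
    congruent (form_of u) (form_of v) -> isomorphic (alg u) (alg v).
  move=> uA vA /congruent_isomorphic uv.
  apply: isomorphic_trans (isomorphic_eq (fun x y => alg_form x y uA)) _.
  by apply: isomorphic_trans uv (isomorphic_eq _) => x y; rewrite alg_form.
case: s => [||a||a||||||||a] //; case: t => [||b||b||||||||b] //=.
- by move=> [a0 ->]; apply: form => //; apply: G3_inv.
- by move=> [a0 ->]; apply: form => //; apply: A1_inv.
- by move=> ->; apply: N6_opp.
Qed.

End ExceptionalIsomorphisms.

(** * Invariants of the algebras with a line of squares *)

Section SquareInvariants.
Context {C : numClosedFieldType}.
Implicit Types p t r a b c : C.

(** Whether q is degenerate, w is a multiple of e2, w is zero, and w is isotropic. *)
Definition square_invariant p t r a b c :=
  (p * r - t ^+ 2 == 0, (a == 0) && (c == 0), [&& a == 0, b == 0 & c == 0],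
   p * a ^+ 2 + 2 * t * a * c + r * c ^+ 2 == 0).

(** An isomorphism maps e2 to k e2, since e2 spans the squares, and induces a map
    with determinant D on the quotient plane, with rows (u1, u3) and (v1, v3). It
    multiplies q by k and maps w to D w'. *)
Lemma square_alg_isomorphic p t r a b c p' t' r' a' b' c' :
  [|| p != 0, t != 0 | r != 0] ->
  isomorphic (square_alg p t r a b c) (square_alg p' t' r' a' b' c') ->
  exists (k u1 u2 u3 v1 v2 v3 : C) (D := u1 * v3 - u3 * v1),
    [/\ k != 0, D != 0,
        [/\ k * p = p' * u1 ^+ 2 + 2 * t' * u1 * u3 + r' * u3 ^+ 2,
            k * t = p' * u1 * v1 + t' * (u1 * v3 + u3 * v1) + r' * u3 * v3 &
            k * r = p' * v1 ^+ 2 + 2 * t' * v1 * v3 + r' * v3 ^+ 2] &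
        [/\ a * u1 + c * v1 = D * a', a * u2 + b * k + c * v2 = D * b' &
            a * u3 + c * v3 = D * c']].
Proof.
move=> q0 /mx_isomorphic[P P0 PM].
have E x1 x2 x3 y1 y2 y3 := PM (rv3 x1 x2 x3) (rv3 y1 y2 y3); move: E P0.
rewrite (mx3_eta P); move: (P i1 i1) (P i1 i2) (P i1 i3) (P i2 i1) (P i2 i2) (P i2 i3)
  (P i3 i1) (P i3 i2) (P i3 i3) => u1 u2 u3 k1 k k3 v1 v2 v3 {}PM P0.
have two0 : 2 != 0 :> C by rewrite pnatr_eq0.
have := PM 1 0 0 0 0 1; have := PM 0 0 1 1 0 0; have := PM 1 0 0 1 0 0; have := PM 0 0 1 0 0 1.
rewrite {PM} !rv3M !square_algE !rv3M => /rv3_inj[R1 R2 R3] /rv3_inj[P1 P2 P3].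
move=> /rv3_inj[B1 B2 B3] /rv3_inj[A1 A2 A3].
have eq_sub (x y l l' : C) : l = l' -> x - y = l - l' -> x = y.
  by move=> -> E; apply: subr0_eq; rewrite E subrr.
have k10 : k1 = 0.
  case/or3P: q0 => q0; apply: (mulfI q0); first by apply: (eq_sub _ _ _ _ P1); ring.
    by apply: (mulfI two0); apply: (eq_sub _ _ _ _ (congr2 +%R A1 B1)); ring.
  by apply: (eq_sub _ _ _ _ R1); ring.
have k30 : k3 = 0.
  case/or3P: q0 => q0; apply: (mulfI q0); first by apply: (eq_sub _ _ _ _ P3); ring.
    by apply: (mulfI two0); apply: (eq_sub _ _ _ _ (congr2 +%R A3 B3)); ring.
  by apply: (eq_sub _ _ _ _ R3); ring.
subst k1 k3; exists k, u1, u2, u3, v1, v2, v3.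
have detE : \det (mx3 u1 u2 u3 0 k 0 v1 v2 v3) = k * (u1 * v3 - u3 * v1).
  by rewrite det_mx3; ring.
move: P0; rewrite detE mulf_eq0 negb_or => /andP[k0 D0]; split=> //; split.
- by apply: (eq_sub _ _ _ _ P2); ring.
- by apply: (mulfI two0); apply: (eq_sub _ _ _ _ (congr2 +%R A2 B2)); ring.
- by apply: (eq_sub _ _ _ _ R2); ring.
- by apply: (mulfI two0); apply: (eq_sub _ _ _ _ (congr2 (fun x y => x - y) A1 B1)); ring.
- by apply: (mulfI two0); apply: (eq_sub _ _ _ _ (congr2 (fun x y => x - y) A2 B2)); ring.
- by apply: (mulfI two0); apply: (eq_sub _ _ _ _ (congr2 (fun x y => x - y) A3 B3)); ring.
Qed.

(** The discriminants satisfy k^2 disc = D^2 disc', and the values at w satisfy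
    k q(w) = D^2 q'(w'). *)
Lemma square_invariant_isomorphic p t r a b c p' t' r' a' b' c' :
  [|| p != 0, t != 0 | r != 0] ->
  isomorphic (square_alg p t r a b c) (square_alg p' t' r' a' b' c') ->
  square_invariant p t r a b c = square_invariant p' t' r' a' b' c'.
Proof.
move=> q0 /(square_alg_isomorphic q0)[k [u1 [u2 [u3 [v1 [v2 [v3]]]]]]].
set D := _ - _ => -[k0 D0 [kp kt kr] [Ea Eb Ec]].
have scale (x y z w : C) : x != 0 -> z != 0 -> x * y = z * w -> (y == 0) = (w == 0).
  by move=> x0 z0 E; rewrite -(mulrI_eq0 y (lregP x0)) E (mulrI_eq0 w (lregP z0)).
have disc : k ^+ 2 * (p * r - t ^+ 2) = D ^+ 2 * (p' * r' - t' ^+ 2).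
  have -> : k ^+ 2 * (p * r - t ^+ 2) = (k * p) * (k * r) - (k * t) ^+ 2 by ring.
  by rewrite kp kt kr /D; ring.
have value : k * (p * a ^+ 2 + 2 * t * a * c + r * c ^+ 2) =
             D ^+ 2 * (p' * a' ^+ 2 + 2 * t' * a' * c' + r' * c' ^+ 2).
  have -> : k * (p * a ^+ 2 + 2 * t * a * c + r * c ^+ 2) =
      (k * p) * a ^+ 2 + 2 * (k * t) * a * c + (k * r) * c ^+ 2 by ring.
  have -> : D ^+ 2 * (p' * a' ^+ 2 + 2 * t' * a' * c' + r' * c' ^+ 2) =
      p' * (D * a') ^+ 2 + 2 * t' * (D * a') * (D * c') + r' * (D * c') ^+ 2 by ring.
  by rewrite kp kt kr -Ea -Ec; ring.
have ac : (a == 0) && (c == 0) = (a' == 0) && (c' == 0).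
  apply/andP/andP => -[/eqP a0 /eqP c0].
    by split; rewrite -(mulrI_eq0 _ (lregP D0)) -?Ea -?Ec a0 c0 !mul0r addr0.
  rewrite a0 mulr0 in Ea; rewrite c0 mulr0 in Ec.
  split; rewrite -(mulrI_eq0 _ (lregP D0)) /D; apply/eqP.
    have -> : (u1 * v3 - u3 * v1) * a =
        v3 * (a * u1 + c * v1) - v1 * (a * u3 + c * v3) by ring.
    by rewrite Ea Ec !mulr0 subrr.
  have -> : (u1 * v3 - u3 * v1) * c =
      u1 * (a * u3 + c * v3) - u3 * (a * u1 + c * v1) by ring.
  by rewrite Ea Ec !mulr0 subrr.
have abc (x y z : C) : [&& x == 0, y == 0 & z == 0] = ((x == 0) && (z == 0)) && (y == 0).
  by rewrite -andbA [(z == 0) && _]andbC.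
rewrite /square_invariant (scale _ _ _ _ _ _ disc) ?expf_neq0 //.
rewrite (scale _ _ _ _ k0 _ value) ?expf_neq0 // !abc -ac.
case: (boolP (_ && _)) => //= /andP[/eqP a0 /eqP c0]; rewrite a0 c0 in Eb.
by rewrite (scale k b D b') // -Eb; ring.
Qed.

(** Here k a = D b, and k^2 = D^2 by comparison of the discriminants. *)
Lemma N6_isomorphic (a b : C) :
  isomorphic (square_of (N6 a)) (square_of (N6 b)) -> a = b \/ b = - a.
Proof.
case/square_alg_isomorphic=> [|k [u1 [u2 [u3 [v1 [v2 [v3]]]]]]]; first by rewrite oner_neq0.
set D := _ - _ => -[k0 D0 [kp kt kr] [_ Eb _]].
have kD : k ^+ 2 = D ^+ 2.
  have -> : k ^+ 2 = (k * 1) * (k * 1) - (k * 0) ^+ 2 by ring.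
  by rewrite {1}kp kt kr /D; ring.
have : a ^+ 2 == b ^+ 2.
  have k20 : k ^+ 2 != 0 by rewrite expf_neq0.
  apply/eqP/(mulfI k20); rewrite {2}kD -!exprMn -Eb; ring.
rewrite eqf_sqr => /orP[/eqP -> | /eqP ->]; [left | right] => //.
by rewrite opprK.
Qed.

Lemma square_invariantE s :
  ~~ anticommutative s ->
  exists p t r a b c : C,
    [/\ square_of s = square_alg p t r a b c, [|| p != 0, t != 0 | r != 0] &
     square_invariant p t r a b c =
     match s with
     | N1 => (true, true, true, true)
     | N2 => (true, false, false, false)
     | N3 => (true, false, false, true)
     | N4 => (true, true, false, true)
     | N5 => (false, false, false, false)
     | N6 a => (false, true, a == 0, true)
     | _ => (true, true, true, true)
     end].
Proof.
case: s => [||a||a||||||||a] // _;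
  [exists 1, 0, 0, 0, 0, 0 | exists 1, 0, 0, 1, 0, 0 | exists 1, 0, 0, 0, 0, 1
  | exists 1, 0, 0, 0, 1, 0 | exists 1, 0, 1, 0, 0, 1 | exists 1, 0, 1, 0, a, 0];
  split; rewrite ?oner_neq0 ?orbT // /square_invariant !expr2;
  by rewrite ?(mul0r, mulr0, mul1r, mulr1, oppr0, addr0, add0r, subr0) ?eqxx ?oner_eq0 ?andbT.
Qed.

End SquareInvariants.

(** * The classification *)

Section Classification.
Context {C : numClosedFieldType}.
Implicit Types s t : name C.

Lemma two_neq0 : 2 != 0 :> C.
Proof. by rewrite pnatr_eq0. Qed.

Lemma cube_zero_alternating (V : lmodType C) (m : {bilinear V -> V -> V}) :
  (forall x, m x x = 0) -> cube_zero m.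
Proof. by move=> alt x; rewrite alt linear0r linear0l. Qed.

Lemma square_alg_cube_zero (p t r a b c : C) : cube_zero (square_alg p t r a b c).
Proof.
by move=> x; rewrite (rv3_eta x) !square_algE -!rv30; split; congr rv3; ring.
Qed.

Lemma alg_cube_zero s : cube_zero (alg s).
Proof.
have [sA | sN] := boolP (anticommutative s).
  apply/(cube_zero_isomorphic (alg_form_iso sA))/cube_zero_alternating.
  exact: form_alg_alternating.
apply/(cube_zero_isomorphic (alg_square_iso sN)).
have [p [t [r [a [b [c [-> _ _]]]]]]] := square_invariantE sN.
exact: square_alg_cube_zero.
Qed.

Lemma symmetric_mono_leibniz_listed (V : vectType C) (mul : {bilinear V -> V -> V}) :
  \dim {:V} = 3%N ->
  symmetric_mono_leibniz mul ->
  [\/ zero_algebra mul, exists s : name C, isomorphic mul (alg s) |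
      isomorphic mul missing_alg].
Proof.
move=> dimV /cube_zero_of_mono_leibniz cube.
have [[x xx0] | alt] : (exists x, mul x x != 0) \/ (forall x, mul x x = 0).
  have [[x xx0] | no] := boolp.pselect (exists x, mul x x != 0); first by left; exists x.
  by right=> x; apply/eqP/negPn/negP => xx0; apply: no; exists x.
  have [t [r [a [b [c iso]]]]] := isomorphic_square_alg two_neq0 dimV cube xx0.
  have [[s sP] | mP] := listed_square t r a b c.
    by apply: Or32; exists s; apply: isomorphic_trans iso sP.
  by apply: Or33; apply: isomorphic_trans iso mP.
have [M iso] := isomorphic_form_alg dimV alt.
have [M0 | [s sA sM]] := forms_classified M.
  apply: Or31 => x y; have [f [g fK gK] fM] := isomorphic_trans iso (congruent_isomorphic M0).
  by apply: (can_inj fK); rewrite fM form_algE mulmx0 linear0.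
apply: Or32; exists s.
apply: isomorphic_trans (isomorphic_trans iso (congruent_isomorphic sM)) _.
by apply: isomorphic_eq => x y; rewrite alg_form.
Qed.

Lemma listed_symmetric_mono_leibniz (V : vectType C) (mul : {bilinear V -> V -> V}) :
  [\/ zero_algebra mul, exists s : name C, isomorphic mul (alg s) |
      isomorphic mul missing_alg] ->
  symmetric_mono_leibniz mul.
Proof.
move=> mP; apply: (mono_leibniz_of_cube_zero two_neq0).
case: mP => [mul0 | [s iso] | iso].
- by apply: cube_zero_alternating => x; apply: mul0.
- by apply/(cube_zero_isomorphic iso)/alg_cube_zero.
- apply/(cube_zero_isomorphic (isomorphic_trans iso missing_alg_iso)).
  exact: square_alg_cube_zero.
Qed.

Lemma square_alg_not_alternating (p t r a b c : C) :
  [|| p != 0, t != 0 | r != 0] -> ~ forall x, square_alg p t r a b c x x = 0.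
Proof.
move=> q0 alt.
have E x y : p * x ^+ 2 + 2 * t * x * y + r * y ^+ 2 = 0.
  have := alt (rv3 x 0 y); rewrite square_algE -rv30 => /rv3_inj[_ <- _]; ring.
have p0 : p = 0 by rewrite -[RHS](E 1 0); ring.
have r0 : r = 0 by rewrite -[RHS](E 0 1); ring.
have t0 : t = 0.
  by apply: (mulfI two_neq0); rewrite mulr0 -[RHS](E 1 1) p0 r0; ring.
by rewrite p0 t0 r0 eqxx in q0.
Qed.

Lemma square_alg_not_form (p t r a b c : C) s :
  [|| p != 0, t != 0 | r != 0] -> anticommutative s ->
  ~ isomorphic (square_alg p t r a b c) (alg s).
Proof.
move=> q0 sA /isomorphic_sym/isomorphic_alternating alt.
apply: (square_alg_not_alternating q0 (alt _)) => x.
by rewrite alg_form // form_alg_alternating.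
Qed.

Lemma missing_alg_not_listed s : ~ isomorphic missing_alg (alg s).
Proof.
move=> /(isomorphic_trans (isomorphic_sym missing_alg_iso)) iso.
have q0 : [|| 0 != 0 :> C, 1 != 0 :> C | 0 != 0 :> C] by rewrite oner_neq0 orbT.
have [sA | sN] := boolP (anticommutative s); first exact: square_alg_not_form sA iso.
have := isomorphic_trans iso (alg_square_iso sN).
have [p [t [r [a [b [c [-> _ inv]]]]]]] := square_invariantE sN.
move/(square_invariant_isomorphic q0); rewrite inv /square_invariant.
rewrite !expr2 !(mul0r, mulr0, mul1r, mulr1, addr0, add0r, subr0) !eqxx !oner_eq0.
rewrite oppr_eq0 oner_eq0.
by case: s sN {iso inv}.
Qed.

(** Vanishing squares separate the two halves of the list; inside each half the
    invariants leave only G1 against G3 and pairs with the same name. *)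
Lemma isomorphic_algE s t :
  isomorphic (alg s) (alg t) <-> s = t \/ exceptional_pair s t.
Proof.
split; last first.
  case=> [-> | ]; [exact: isomorphic_eq | exact: exceptional_isomorphic].
have unequal (c : C) : c = - 1 -> c = 1 -> False.
  by move=> -> /eqP; rewrite -subr_eq0 -opprD oppr_eq0 (negbTE two_neq0).
have [sA | sN] := boolP (anticommutative s); have [tA | tN] := boolP (anticommutative t).
- move=> /(isomorphic_trans (isomorphic_sym (alg_form_iso sA))) iso.
  have {}iso := isomorphic_trans iso (alg_form_iso tA).
  have [P P0 PM] := form_alg_isomorphic iso.
  have := form_invariant_isomorphic P0 PM; rewrite !form_invariantE //.
  case: s t sA tA iso {P P0 PM} => [||a||a||||||||a] [||b||b||||||||b] //= _ _ iso;
    move=> /eqP; rewrite !xpair_eqE ?andbF //= => inv; try by left.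
  + case: (eqVneq b (- 1)) inv => [/unequal | //].
    by case: (eqVneq b 1) => [E /(_ E) | ].
  + case: (eqVneq a (- 1)) inv => [/unequal | //].
    by case: (eqVneq a 1) => [E /(_ E) | ].
  + by case: (G3_isomorphic iso) => [-> | ?]; [left | right].
  + by case: (A1_isomorphic iso) => [-> | ?]; [left | right].
- move=> /isomorphic_sym/(isomorphic_trans (isomorphic_sym (alg_square_iso tN))).
  have [p [q [r [a [b [c [-> q0 _]]]]]]] := square_invariantE tN.
  by move/(square_alg_not_form q0 sA).
- move=> /(isomorphic_trans (isomorphic_sym (alg_square_iso sN))).
  have [p [q [r [a [b [c [-> q0 _]]]]]]] := square_invariantE sN.
  by move/(square_alg_not_form q0 tA).
move=> /(isomorphic_trans (isomorphic_sym (alg_square_iso sN))) iso.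
have {iso} := isomorphic_trans iso (alg_square_iso tN).
have [p [q [r [a [b [c [sE q0 sinv]]]]]]] := square_invariantE sN.
have [p' [q' [r' [a' [b' [c' [tE _ tinv]]]]]]] := square_invariantE tN.
move=> iso; have := iso; rewrite sE tE => /(square_invariant_isomorphic q0).
rewrite sinv tinv {sE tE sinv tinv q0}.
case: s t sN tN iso => [||d||d||||||||d] [||e||e||||||||e] //= _ _ iso /eqP;
  rewrite !xpair_eqE ?andbF //= => inv; try by left.
by case: (N6_isomorphic iso) => ->; [left | right].
Qed.

End Classification.

Theorem corollary10 (R : realType) :
  [/\ forall (V : vectType R[i]) (mul : {bilinear V -> V -> V}),
        \dim {:V} = 3%N ->
        (symmetric_mono_leibniz mul <->
         [\/ zero_algebra mul,
             exists s : name R[i], isomorphic mul (alg s) |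
             isomorphic mul missing_alg]),
      forall s t : name R[i],
        isomorphic (alg s) (alg t) <-> s = t \/ exceptional_pair s t &
      forall s : name R[i], ~ isomorphic missing_alg (alg s)].
Proof.
split=> [V mul dimV | s t | s].
- split; first exact: symmetric_mono_leibniz_listed.
  exact: listed_symmetric_mono_leibniz.
- exact: isomorphic_algE.
- exact: missing_alg_not_listed.
Qed.
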